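(* Let $M$ be a matroid of rank $r$ on $[\widetilde n]:=\{0\}\sqcup[n]$ such that $0$ is neither a loop nor a coloop of $M$. Let $\widetilde T=\mathbb C^*\times T=(\mathbb C^* )^{n+1}$ with character ring $\mathbb Z[t_0^{\pm1},\dots,t_n^{\pm1}]$ and $T=(\mathbb C^* )^n$ with character ring $\mathbb Z[t_1^{\pm1},\dots,t_n^{\pm1}]$. Then \[ K\mathcal T^{\widetilde T}_{M,M}(x,y)=t_0^2\,K\mathcal T^T_{M/0,M/0}(x,y)+t_0\,K\mathcal T^T_{M/0,M\setminus0}(x,y)+K\mathcal T^T_{M\setminus0,M\setminus0}(x,y). \] In particular $K\mathcal T_{M,M}(x,y)=K\mathcal T_{M/0,M/0}(x,y)+K\mathcal T_{M/0,M\setminus0}(x,y)+K\mathcal T_{M\setminus0,M\setminus0}(x,y)$.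
   Context: For a flag matroid $\mathbf M=(M_1,\dots,M_k)$ on a finite ground set $E$ (a sequence of matroids on $E$ with $\operatorname{rk}_{M_{i+1}}(B)-\operatorname{rk}_{M_{i+1}}(A)\ge\operatorname{rk}_{M_i}(B)-\operatorname{rk}_{M_i}(A)$ for all $A\subseteq B\subseteq E$; repetitions allowed), with ranks $r_1\le\dots\le r_k$ and torus $(\mathbb C^* )^E$ with variables $t_e$: bases are flags $\mathbf B=(B_1\subseteq\cdots\subseteq B_k)$ with $B_i$ a basis of $M_i$; $\mathbf e_S=\sum_{e\in S}\mathbf e_e$; $Q(\mathbf M)=\operatorname{Conv}\{\sum_i\mathbf e_{B_i}\}$; $\operatorname{Cone}_{\mathbf B}(\mathbf M)$ is the cone generated by $Q(\mathbf M)-\sum_i\mathbf e_{B_i}$; $\operatorname{Hilb}(C)$ is the multigraded Hilbert series (a rational function) of $\mathbb C[\mathbf t^\lambda:\lambda\in C\cap\mathbb Z^E]$. The equivariant flag-geometric Tutte polynomial is the Laurent polynomial \[K\mathcal T^T_{\mathbf M}(u+1,v+1)=\sum_{\mathbf B}\operatorname{Hilb}(\operatorname{Cone}_{\mathbf B}(\mathbf M))\sum_{\mathfrak p\subseteq B_k}\sum_{\mathfrak q\subseteq E\setminus B_1}\mathbf t^{\mathbf e_{B_1}+\cdots+\mathbf e_{B_{k-1}}+\mathbf e_{\mathfrak p}+\mathbf e_{\mathfrak q}}u^{r_k-|\mathfrak p|}v^{|\mathfrak q|}\] (this equals $\sum_{p,q}\chi^T(y(\mathbf M)^T[\mathcal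 O(\mathbf 1)]^T[\bigwedge^p\mathcal S_k]^T[\bigwedge^q\mathcal Q_1^\vee]^T)u^pv^q$ on the flag variety, where $y(\mathbf M)^T$ is the equivariant $K$-class of $\mathbf M$). $K\mathcal T_{\mathbf M}(x,y)$ is obtained by setting all $t_e=1$. Here $(M,M)$ is on $[\widetilde n]$, and $(M/0,M/0)$, $(M/0,M\setminus0)$, $(M\setminus0,M\setminus0)$ are flag matroids on $[n]$. *)

(* Defs.v *)
From HB Require Import structures.
From mathcomp Require Import boolp classical_sets reals.
From mathcomp Require Import all_boot all_order all_algebra.
From mathcomp Require Import fraction ssrcomplements mpoly zify.

Set Implicit Arguments.
Unset Strict Implicit.
Unset Printing Implicit Defensive.

Import Order.TTheory GRing.Theory Num.Theory.

Local Open Scope ring_scope.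

Record matroid (n : nat) := Matroid {
  rk :> {set 'I_n} -> nat;
  rk_le_card : forall A, (rk A <= #|A|)%N;
  rk_mono : forall A B : {set 'I_n}, A \subset B -> (rk A <= rk B)%N;
  rk_submod : forall A B : {set 'I_n},
    (rk (A :|: B) + rk (A :&: B) <= rk A + rk B)%N }.

Definition mrank n (M : matroid n) : nat := M [set: 'I_n].

Definition is_basis n (M : matroid n) (B : {set 'I_n}) : bool :=
  (M B == #|B|) && (M B == mrank M).

Definition is_loop n (M : matroid n) (e : 'I_n) : bool := M [set e] == 0%N.

Definition is_coloop n (M : matroid n) (e : 'I_n) : bool :=
  [forall B, is_basis M B ==> (e \in B)].

Section Minors.
Variables (n : nat) (M : matroid n.+1) (e : 'I_n.+1).

(* The ground set [set~ e] is identified with 'I_n through lift e. *)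
Let up (A : {set 'I_n}) : {set 'I_n.+1} := lift e @: A.

Definition delete_rk (A : {set 'I_n}) : nat := M (up A).
Definition contract_rk (A : {set 'I_n}) : nat := (M (e |: up A) - M [set e])%N.

Let upS (A B : {set 'I_n}) : A \subset B -> up A \subset up B.
Proof. exact: imsetS. Qed.
Let upU A B : up (A :|: B) = up A :|: up B.
Proof. exact: imsetU. Qed.
Let upI A B : up (A :&: B) = up A :&: up B.
Proof. by rewrite /up imsetI // => x y _ _; apply: lift_inj. Qed.
Let card_up A : #|up A| = #|A|.
Proof. by rewrite card_imset //; apply: lift_inj. Qed.
Let le1 A : (M [set e] <= M (e |: A))%N.
Proof. by apply: rk_mono; rewrite subsetUl. Qed.

Lemma delete_le_card A : (delete_rk A <= #|A|)%N.
Proof. by rewrite -card_up; apply: rk_le_card. Qed.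
Lemma delete_mono (A B : {set 'I_n}) : A \subset B -> (delete_rk A <= delete_rk B)%N.
Proof. by move=> /upS; apply: rk_mono. Qed.
Lemma delete_submod A B :
  (delete_rk (A :|: B) + delete_rk (A :&: B) <= delete_rk A + delete_rk B)%N.
Proof. by rewrite /delete_rk upU upI; apply: rk_submod. Qed.

Definition delete : matroid n := Matroid delete_le_card delete_mono delete_submod.

Lemma contract_le_card A : (contract_rk A <= #|A|)%N.
Proof.
rewrite /contract_rk leq_subLR -card_up.
apply: leq_trans (leq_add (leqnn _) (rk_le_card M (up A))).
by apply: leq_trans (leq_addr _ _) (rk_submod M _ _).
Qed.
Lemma contract_mono (A B : {set 'I_n}) : A \subset B -> (contract_rk A <= contract_rk B)%N.
Proof. by move=> /upS AB; rewrite leq_sub2r // rk_mono // setUS. Qed.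
Lemma contract_submod A B :
  (contract_rk (A :|: B) + contract_rk (A :&: B)
     <= contract_rk A + contract_rk B)%N.
Proof.
have := rk_submod M (e |: up A) (e |: up B).
rewrite -setUUr -setUIr -upU -upI /contract_rk.
move: (le1 (up A)) (le1 (up B)) (le1 (up (A :|: B))) (le1 (up (A :&: B))).
move: (M [set e]) (M (e |: up A)) (M (e |: up B)) (M (e |: up (A :|: B)))
  (M (e |: up (A :&: B))) => a b c d f.
by lia.
Qed.

Definition contract : matroid n :=
  Matroid contract_le_card contract_mono contract_submod.

End Minors.

(* The differences are those of monotone functions, hence never truncated. *)
Definition matroid_quotient n (M N : matroid n) : Prop :=
  forall A B : {set 'I_n}, A \subset B -> (M B - M A <= N B - N A)%N.

(* A flag matroid (M_1, ..., M_k.+1), with M_(i.+1) in position i : 'I_k.+1. *)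
Record flag_matroid (n k : nat) := FlagMatroid {
  constituent :> 'I_k.+1 -> matroid n;
  constituentP : forall i j : 'I_k.+1, j = i.+1 :> nat ->
    matroid_quotient (constituent i) (constituent j) }.

Section TwoStep.
Variables (n : nat) (M N : matroid n) (MN : matroid_quotient M N).

Definition flag2_fun (i : 'I_2) : matroid n := if i == ord0 then M else N.

Lemma flag2_funP (i j : 'I_2) :
  j = i.+1 :> nat -> matroid_quotient (flag2_fun i) (flag2_fun j).
Proof. by case: i j => [[|[|i]] Hi] [[|[|j]] Hj]. Qed.

Definition flag2 : flag_matroid n 1 := FlagMatroid flag2_funP.
End TwoStep.

Lemma quotient_refl n (M : matroid n) : matroid_quotient M M.
Proof. by []. Qed.

Lemma contract_delete_quotient n (M : matroid n.+1) (e : 'I_n.+1) :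
  matroid_quotient (contract M e) (delete M e).
Proof.
move=> A B AB; rewrite /= /contract_rk /delete_rk.
set a := lift e @: A; set b := lift e @: B.
have ab : a \subset b by apply: imsetS.
have eb : e \notin b by apply/imsetP => -[x _ /eqP]; rewrite (negPf (neq_lift e x)).
have := rk_submod M (e |: a) b.
have -> : (e |: a) :|: b = e |: b by rewrite -setUA (setUidPr ab).
have -> : (e |: a) :&: b = a.
  by rewrite setIUl (setIidPl ab) disjoint_setI0 ?set0U // disjoints1.
have h1 : (M [set e] <= M (e |: a))%N by apply: rk_mono; rewrite subsetUl.
have h2 : (M (e |: a) <= M (e |: b))%N by apply: rk_mono; rewrite setUS.
have h3 : (M a <= M b)%N by apply: rk_mono.
move: (M [set e]) (M a) (M b) (M (e |: a)) (M (e |: b)) => x y z t u.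
by lia.
Qed.

Section FlagBases.
Variables (n k : nat) (M : flag_matroid n k).

Definition is_flag_basis (B : {ffun 'I_k.+1 -> {set 'I_n}}) : bool :=
  [forall i, is_basis (M i) (B i)] &&
  [forall i : 'I_k.+1, forall j : 'I_k.+1, (j == i.+1 :> nat) ==> (B i \subset B j)].
End FlagBases.

Section Cones.
Local Open Scope classical_set_scope.
Variables (R : realFieldType) (n : nat).

Definition conv_hull (S : set 'rV[R]_n) : set 'rV[R]_n :=
  [set x | exists m (c : 'I_m -> R) (s : 'I_m -> 'rV[R]_n),
     [/\ forall i, 0 <= c i, \sum_i c i = 1, forall i, S (s i)
       & x = \sum_i c i *: s i]].

Definition cone_hull (S : set 'rV[R]_n) : set 'rV[R]_n :=
  [set x | exists m (c : 'I_m -> R) (s : 'I_m -> 'rV[R]_n),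
     [/\ forall i, 0 <= c i, forall i, S (s i) & x = \sum_i c i *: s i]].

Definition indic_vec (S : {set 'I_n}) : 'rV[R]_n := \row_e (e \in S)%:R.

Variables (k : nat) (M : flag_matroid n k).

Definition flag_vec (B : {ffun 'I_k.+1 -> {set 'I_n}}) : 'rV[R]_n :=
  \sum_i indic_vec (B i).

Definition flag_polytope : set 'rV[R]_n :=
  conv_hull [set flag_vec B | B in [set B | is_flag_basis M B]].

Definition flag_cone (B : {ffun 'I_k.+1 -> {set 'I_n}}) : set 'rV[R]_n :=
  cone_hull [set x - flag_vec B | x in flag_polytope].
End Cones.

(* Rational functions in t_0, ..., t_(n-1), a field which is also the fraction
   field of the ring of Laurent polynomials. *)
Notation ratfun n := {fraction {mpoly int[n]}}.

Definition tfrac (n : nat) (p : {mpoly int[n]}) : ratfun n :=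
  FracField.tofrac p.

Lemma frac_numden n (f : ratfun n) : f = tfrac \n_(repr f) / tfrac \d_(repr f).
Proof.
have d0 : \d_(repr f) != 0 by apply: denom_ratioP.
apply: (canRL (mulfK _)); first by rewrite tofrac_eq0.
rewrite -{1}[f]reprK /tfrac; unlock FracField.tofrac.
rewrite -[LHS]FracField.pi_mul; apply/eqmodP.
rewrite /= FracField.equivfE /FracField.mulf !numden_Ratio ?mulr1 ?oner_neq0 //.
by rewrite mulrC.
Qed.

Lemma tfrac_subdiv n (a b c d : {mpoly int[n]}) : b != 0 -> d != 0 ->
  tfrac a / tfrac b - tfrac c / tfrac d = tfrac (a * d - c * b) / tfrac (b * d).
Proof.
move=> b0 d0; rewrite /tfrac tofracB !tofracM -mulNr addf_div ?tofrac_eq0 //.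
by rewrite mulNr.
Qed.

Lemma tfrac_muldiv n (a b c d : {mpoly int[n]}) :
  (tfrac a / tfrac b) * (tfrac c / tfrac d) = tfrac (a * c) / tfrac (b * d).
Proof. by rewrite mulf_div /tfrac !tofracM. Qed.

Section Hilbert.
Variable n : nat.

Definition expt (m : 'X_{1..n}) : 'rV[int]_n := \row_i (m i)%:Z.

(* Formal two-sided series in t are given by their coefficients, indexed by Z^n;
   they form a module over Z[t]. *)
Definition series_mul (p : {mpoly int[n]}) (S : 'rV[int]_n -> int)
    (l : 'rV[int]_n) : int :=
  \sum_(m <- msupp p) p@_m * S (l - expt m).

Definition series_one (l : 'rV[int]_n) : int := (l == 0)%:R.

Definition hilb_series (R : realFieldType) (C : set 'rV[R]_n)
    (l : 'rV[int]_n) : int :=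
  `[< C (map_mx (fun z : int => z%:~R) l) >]%:R.

(* In the semigroup algebra of the lattice points of C, degree l has dimension 1 or 0,
   which gives hilb_series; f = p / q is the sum of the series S when q * S = p.
   Clearing monomials, it is enough to take p and q in Z[t] rather than Laurent
   polynomials. *)
Definition sums_to (S : 'rV[int]_n -> int) (f : ratfun n) : Prop :=
  exists p q : {mpoly int[n]},
    [/\ q != 0, f = tfrac p / tfrac q
      & forall l, series_mul q S l = series_mul p series_one l].

(* The value f is unique by sums_to_unique; 0 is returned if there is none. *)
Definition Hilb (R : realFieldType) (C : set 'rV[R]_n) : ratfun n :=
  xget 0 [set f | sums_to (hilb_series C) f].

Lemma series_mulE p k S l : (msize p <= k)%N ->
  series_mul p S l = \sum_(m : 'X_{1..n < k}) p@_m * S (l - expt m).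
Proof.
move=> le_pk; set I : subFinType _ := 'X_{1..n < k}.
rewrite /series_mul (big_mksub I) ?msupp_uniq //=; first last.
  by move=> x /msize_mdeg_lt /leq_trans; apply.
by rewrite big_rmcond //= => j /memN_msupp_eq0 ->; rewrite mul0r.
Qed.

Lemma series_mulD p q S l :
  series_mul (p + q) S l = series_mul p S l + series_mul q S l.
Proof.
pose k := (msize p + (msize q + msize (p + q)))%N.
rewrite !(@series_mulE _ k) /k; last 3 first.
- by rewrite addnCA leq_addr.
- by rewrite leq_addr.
- by rewrite addnA leq_addl.
by rewrite -big_split; apply: eq_bigr => m _; rewrite /= mcoeffD mulrDl.
Qed.

Lemma series_mulZX c m S l : series_mul (c *: 'X_[m]) S l = c * S (l - expt m).
Proof.
rewrite (@series_mulE _ (msize (c *: 'X_[m]) + (mdeg m).+1)) ?leq_addr //.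
set k := (_ + _)%N; have mk : (mdeg m < k)%N by rewrite leq_addl.
rewrite (bigD1 (BMultinom mk)) //= mcoeffZ mcoeffX eqxx mulr1.
rewrite big1 ?addr0 // => j jm; rewrite mcoeffZ mcoeffX.
case: eqP => [e|_]; last by rewrite mulr0 mul0r.
by case/eqP: jm; apply: val_inj.
Qed.

Lemma series_mul0 S l : series_mul 0 S l = 0.
Proof. by rewrite /series_mul msupp0 big_nil. Qed.

Lemma exptD m1 m2 : expt (m1 + m2)%MM = expt m1 + expt m2.
Proof. by apply/rowP => i; rewrite !mxE mnmDE PoszD. Qed.

Lemma series_mulM p q S l :
  series_mul (p * q) S l = series_mul p (series_mul q S) l.
Proof.
elim/mpolyind: p => [|c m p _ _ IHp]; first by rewrite mul0r !series_mul0.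
rewrite mulrDl !series_mulD IHp series_mulZX; congr (_ + _).
elim/mpolyind: q {IHp} => [|d m' q _ _ IHq].
  by rewrite mulr0 !series_mul0 mulr0.
rewrite mulrDr !series_mulD IHq mulrDr; congr (_ + _).
rewrite -scalerAl -scalerAr scalerA -mpolyXD !series_mulZX mulrA exptD.
by rewrite opprD addrA.
Qed.

Lemma series_mul_one p m : series_mul p series_one (expt m) = p@_m.
Proof.
rewrite -[RHS]/(mcoeff m p); elim/mpolyind: p => [|c m' p _ _ IHp].
  by rewrite series_mul0 mcoeff0.
rewrite series_mulD IHp mcoeffD series_mulZX mcoeffZ mcoeffX; congr (_ * _ + _).
rewrite /series_one subr_eq0 eq_sym; congr (_%:R); congr nat_of_bool.
apply/eqP/eqP => [/rowP e|-> //]; apply/mnmP => i.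
by have := e i; rewrite !mxE => -[].
Qed.

Lemma sums_to_unique S f g : sums_to S f -> sums_to S g -> f = g.
Proof.
move=> [p [q [q0 -> Sf]]] [p' [q' [q'0 -> Sg]]].
suff e : p * q' = p' * q.
  apply/eqP; rewrite /tfrac eqr_div ?tofrac_eq0 // -!rmorphM /=.
  by apply/eqP; congr FracField.tofrac.
apply/mpolyP => m; rewrite -!series_mul_one mulrC [p' * q]mulrC !series_mulM.
transitivity (series_mul (q' * q) S (expt m)).
  by rewrite series_mulM; apply: eq_bigr => k _; rewrite Sf.
by rewrite mulrC series_mulM; apply: eq_bigr => k _; rewrite Sg.
Qed.

Lemma HilbE (R : realFieldType) (C : set 'rV[R]_n) f :
  sums_to (hilb_series C) f -> Hilb C = f.
Proof.
move=> Cf; rewrite /Hilb; case: xgetP => [g _ Cg|/(_ f)//].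
exact: sums_to_unique Cg Cf.
Qed.
End Hilbert.

Section FlagTutte.
Variables (R : realFieldType) (n k : nat) (M : flag_matroid n k).

(* The monomial t^(e_S). *)
Definition tmon (S : {set 'I_n}) : ratfun n := \prod_(e in S) tfrac 'X_e.

(* The polynomial KT^T(u + 1, v + 1). *)
Definition KTT_shift (u v : {mpoly (ratfun n)[2]}) : {mpoly (ratfun n)[2]} :=
  \sum_(B | is_flag_basis M B)
    Hilb (flag_cone (R := R) M B) *:
    \sum_(p in powerset (B ord_max)) \sum_(q in powerset (~: B ord0))
      ((\prod_(i | i != ord_max) tmon (B i)) * tmon p * tmon q) *:
        (u ^+ (mrank (M ord_max) - #|p|) * v ^+ #|q|).

(* KT^T(x, y), as a polynomial whose variables x and y are 'X_ord0 and 'X_ord_max. *)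
Definition KTT : {mpoly (ratfun n)[2]} :=
  KTT_shift ('X_ord0 - 1) ('X_ord_max - 1).
End FlagTutte.

(* The value at t_e = 1 of a Laurent polynomial p / t^m (see laurent_at1E), and 0
   for a rational function that is not a Laurent polynomial. *)
Definition laurent_at1 n (f : ratfun n) : int :=
  xget 0 [set c | exists (p : {mpoly int[n]}) (m : 'X_{1..n}),
    f = tfrac p / tfrac 'X_[m] /\ c = p.@[fun=> 1]]%classic.

Lemma laurent_at1E n (p : {mpoly int[n]}) m :
  laurent_at1 (tfrac p / tfrac 'X_[m]) = p.@[fun=> 1].
Proof.
have X0 k : 'X_[k] != 0 :> {mpoly int[n]} by rewrite -msize_poly_eq0 msizeX.
have X1 k : ('X_[int, k] : {mpoly int[n]}).@[fun=> 1] = 1.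
  by rewrite mevalX big1 // => i _; rewrite expr1n.
rewrite /laurent_at1; case: xgetP => [c -> [p' [m' [/eqP]]]|/(_ p.@[fun=> 1])].
  rewrite /tfrac eqr_div ?tofrac_eq0 // -!rmorphM tofrac_eq => /eqP e ->.
  have := congr1 (meval (fun=> 1)) e.
  by rewrite !mevalM !X1 !mulr1.
by case; exists p, m.
Qed.

Definition KT (R : realFieldType) n k (M : flag_matroid n k) : {mpoly int[2]} :=
  map_mpoly (@laurent_at1 n) (KTT R M).

Section Relabel.
Variable n : nat.

(* Z[t_0, ..., t_(n-1)] -> Z[t_0, ..., t_n], shifting t_i to t_(i+1): the ground
   set 'I_n of a minor at ord0 sits in 'I_n.+1 through lift ord0. *)
Definition up_poly (p : {mpoly int[n]}) : {mpoly int[n.+1]} :=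
  p \mPo [tuple 'X_(lift ord0 i) | i < n].

HB.instance Definition _ := GRing.RMorphism.copy up_poly
  (comp_mpoly [tuple 'X_(lift ord0 i) | i < n] : {mpoly int[n]} -> _).

Definition up_frac (f : ratfun n) : ratfun n.+1 :=
  tfrac (up_poly \n_(repr f)) / tfrac (up_poly \d_(repr f)).

Lemma up_poly_eq0 p : (up_poly p == 0) = (p == 0).
Proof.
apply/eqP/eqP => [p0|->]; last by rewrite /up_poly raddf0.
rewrite -[LHS](_ : up_poly p \mPo
    [tuple if unlift ord0 i is Some j then 'X_j else 0 | i < n.+1] = _).
  by rewrite p0 raddf0.
rewrite -[RHS]comp_mpoly_id /up_poly.
elim/mpolyind: p {p0} => [|c m p _ _ IHp]; first by rewrite !raddf0.
rewrite !raddfD /= IHp !comp_mpolyZ !comp_mpolyX rmorph_prod; congr (_ *: _ + _).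
apply: eq_bigr => i _; rewrite rmorphXn /= !tnth_mktuple comp_mpolyXU.
by rewrite -tnth_nth tnth_mktuple liftK.
Qed.

Lemma up_fracE p q : q != 0 ->
  up_frac (tfrac p / tfrac q) = tfrac (up_poly p) / tfrac (up_poly q).
Proof.
move=> q0; rewrite /up_frac; set f := tfrac p / _.
have d0 : \d_(repr f) != 0 by apply: denom_ratioP.
apply/eqP; rewrite /tfrac eqr_div ?tofrac_eq0 ?up_poly_eq0 //.
rewrite -!rmorphM /= tofrac_eq; apply/eqP; congr up_poly.
apply/eqP; rewrite -tofrac_eq !rmorphM /= -eqr_div ?tofrac_eq0 //.
by rewrite -frac_numden.
Qed.

Lemma up_frac_is_zmod_morphism : zmod_morphism up_frac.
Proof.
move=> f g; rewrite (frac_numden f) (frac_numden g).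
set a := \n_ _; set b := \d_ _; set c := \n_ _; set d := \d_ _.
have b0 : b != 0 by apply: denom_ratioP.
have d0 : d != 0 by apply: denom_ratioP.
rewrite tfrac_subdiv // !up_fracE ?mulf_neq0 // tfrac_subdiv ?up_poly_eq0 //.
by rewrite (rmorphB up_poly) !(rmorphM up_poly).
Qed.

Lemma up_frac_is_monoid_morphism : monoid_morphism up_frac.
Proof.
split=> [|f g].
  rewrite -[1 in LHS](divr1) -[1 in LHS]tofrac1 up_fracE ?oner_neq0 //.
  by rewrite (rmorph1 up_poly) /tfrac tofrac1 divr1.
rewrite (frac_numden f) (frac_numden g).
set a := \n_ _; set b := \d_ _; set c := \n_ _; set d := \d_ _.
have b0 : b != 0 by apply: denom_ratioP.
have d0 : d != 0 by apply: denom_ratioP.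
rewrite tfrac_muldiv !up_fracE ?mulf_neq0 // tfrac_muldiv.
by rewrite !(rmorphM up_poly).
Qed.

HB.instance Definition _ :=
  GRing.isZmodMorphism.Build (ratfun n) (ratfun n.+1) up_frac
    up_frac_is_zmod_morphism.
HB.instance Definition _ :=
  GRing.isMonoidMorphism.Build (ratfun n) (ratfun n.+1) up_frac
    up_frac_is_monoid_morphism.
End Relabel.

(* Main.v *)
(* Cones are generated by roots e_j - e_i.  For a convex cone C and a vector d,
   [C] + [C + Rd] = [C + R+ d] + [C - R+ d], and a cone containing a line has
   Hilbert series 0; hence [C] is, modulo cones with lines, the sum over i in I of
   the cones C + cone(e_i - e_k, k in I) (Brion).  Applied to the cone of M at a
   basis B with 0 not in B, this gives
     Hilb(Cone_B(M)) = sum_i H_(B-i, B) / (1 - t_0 / t_i),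
     Hilb(Cone_B(M\0)) = sum_i H_(B-i, B),
   where i runs over the elements of B such that B - i + 0 is a basis and H_(B-i, B)
   is the Hilbert series of the cone of (M/0, M\0) at the flag (B - i, B); the same
   holds with the roles reversed at the bases containing 0.  So each side of the
   deletion-contraction formula is a sum over the edges (B, B - i + 0) of H_(B-i, B)
   times an explicit weight.  The weights agree because
     (a^2 (a+u) (1+vb) - b^2 (b+u) (1+va)) / (a - b)
       = b^2 (1+va) + b (a+u) (1+va) + a (a+u)
   at a = t_i, b = t_0.
   Setting t = 1 requires the coefficients to be Laurent polynomials.  For (M, M),
   the partial fraction expansion at an element e shows that the denominators can
   be chosen as products of differences t_i - t_j with i, j <> e; these
   differences are prime and e is arbitrary, so there are no denominators.  The
   case of (M/0, M\0) then follows from the formula itself. *)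
Require Import Defs.
From HB Require Import structures.
From mathcomp Require Import boolp classical_sets reals.
From mathcomp Require Import all_boot all_order all_algebra.
From mathcomp Require Import fraction mpoly ring lra zify.

Set Implicit Arguments.
Unset Strict Implicit.
Unset Printing Implicit Defensive.

Import Order.TTheory GRing.Theory Num.Theory.
Local Open Scope ring_scope.

(** * Cones generated by roots *)

Section ConeHull.
Variables (R : realFieldType) (n : nat).
Implicit Types (S X : set 'rV[R]_n) (x y : 'rV[R]_n).

Lemma cone_hull0 S : cone_hull S 0.
Proof.
by exists 0%N, (fun=> 0), (fun=> 0); split=> [[]|[]|] //; rewrite big_ord0.
Qed.

Lemma cone_hull_gen S x : S x -> cone_hull S x.
Proof.
move=> Sx; exists 1%N, (fun=> 1), (fun=> x).
by split=> //; rewrite big_ord1 scale1r.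
Qed.

Lemma cone_hullZ S a x : 0 <= a -> cone_hull S x -> cone_hull S (a *: x).
Proof.
move=> a0 [m [c [s [c0 Ss ->]]]]; exists m, (fun i => a * c i), s; split=> //.
  by move=> i; rewrite mulr_ge0.
by rewrite scaler_sumr; apply: eq_bigr => i _; rewrite scalerA.
Qed.

Lemma cone_hullD S x y : cone_hull S x -> cone_hull S y -> cone_hull S (x + y).
Proof.
move=> [m [c [s [c0 Ss ->]]]] [m' [c' [s' [c'0 Ss' ->]]]].
exists (m + m')%N,
  (fun i => match split i with inl j => c j | inr j => c' j end),
  (fun i => match split i with inl j => s j | inr j => s' j end).
split; [by move=> i; case: splitP | by move=> i; case: splitP |].
rewrite big_split_ord /=; congr (_ + _); apply: eq_bigr => i _.
  by rewrite (unsplitK (inl i : 'I_m + 'I_m')).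
by rewrite (unsplitK (inr i : 'I_m + 'I_m')).
Qed.

Lemma cone_hull_sum S (I : Type) (r : seq I) (P : pred I) (F : I -> 'rV[R]_n) :
  (forall i, P i -> cone_hull S (F i)) -> cone_hull S (\sum_(i <- r | P i) F i).
Proof.
move=> SF; elim/big_ind: _ => //; [exact: cone_hull0 | exact: cone_hullD].
Qed.

Lemma cone_hull_ind S (X : 'rV[R]_n -> Prop) :
    X 0 -> (forall x y, X x -> X y -> X (x + y)) ->
    (forall a x, 0 <= a -> X x -> X (a *: x)) -> (forall x, S x -> X x) ->
  forall x, cone_hull S x -> X x.
Proof.
move=> X0 XD XZ SX x [m [c [s [c0 Ss ->]]]].
by elim/big_ind: _ => // i _; apply/XZ/SX/Ss.
Qed.

Lemma cone_hull_sub S S' : (forall x, S x -> cone_hull S' x) ->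
  forall x, cone_hull S x -> cone_hull S' x.
Proof.
move=> SS'; apply: cone_hull_ind => //; first exact: cone_hull0.
  exact: cone_hullD.
by move=> a x; apply: cone_hullZ.
Qed.

Definition rootv (i j : 'I_n) : 'rV[R]_n := delta_mx 0 j - delta_mx 0 i.

Lemma rootvv i : rootv i i = 0. Proof. by rewrite /rootv subrr. Qed.
Lemma rootvN i j : - rootv i j = rootv j i. Proof. by rewrite /rootv opprB. Qed.
Lemma rootv_trans i j k : rootv i j + rootv j k = rootv i k.
Proof. by rewrite /rootv addrC addrA subrK. Qed.

Implicit Type D : {set 'I_n * 'I_n}.

Definition gcone D : set 'rV[R]_n :=
  cone_hull [set rootv p.1 p.2 | p in [set p | p \in D]]%classic.

Lemma gcone_root D i j : (i, j) \in D -> gcone D (rootv i j).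
Proof. by move=> Dij; apply: cone_hull_gen; exists (i, j). Qed.

Lemma gcone_ind D (X : 'rV[R]_n -> Prop) :
    X 0 -> (forall x y, X x -> X y -> X (x + y)) ->
    (forall a x, 0 <= a -> X x -> X (a *: x)) ->
    (forall i j, (i, j) \in D -> X (rootv i j)) ->
  forall x, gcone D x -> X x.
Proof.
move=> X0 XD XZ DX; apply: cone_hull_ind => // x [[i j]] /= Dij <-.
exact: DX.
Qed.

Lemma gcone_sub D D' : (forall i j, (i, j) \in D -> gcone D' (rootv i j)) ->
  forall x, gcone D x -> gcone D' x.
Proof.
by move=> DD'; apply: cone_hull_sub => x [[i j]] /= Dij <-; apply: DD'.
Qed.

Lemma gconeS D D' : D \subset D' -> forall x, gcone D x -> gcone D' x.
Proof.
by move=> /subsetP DD'; apply: gcone_sub => i j /DD'; apply: gcone_root.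
Qed.

Lemma gcone_eq D D' :
    (forall i j, (i, j) \in D -> gcone D' (rootv i j)) ->
    (forall i j, (i, j) \in D' -> gcone D (rootv i j)) ->
  gcone D = gcone D'.
Proof.
by move=> h h'; apply/seteqP; split=> x; apply: gcone_sub.
Qed.

Lemma gcone_trans D i j k :
  gcone D (rootv i j) -> gcone D (rootv j k) -> gcone D (rootv i k).
Proof. by rewrite -(rootv_trans i j k); apply: cone_hullD. Qed.

Lemma gcone_xx D i : gcone D (rootv i i).
Proof. by rewrite rootvv; apply: cone_hull0. Qed.

Lemma gconeU1P D p x :
  gcone (p |: D) x <-> exists2 s, 0 <= s & gcone D (x - s *: rootv p.1 p.2).
Proof.
split; last first.
  case=> s s0 Dx; rewrite -[x](subrK (s *: rootv p.1 p.2)).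
  apply: cone_hullD; first by apply: gconeS Dx; apply: subsetUr.
  by apply: cone_hullZ => //; case: (p) => i j; apply/gcone_root/setU11.
elim/gcone_ind.
- by exists 0 => //; rewrite scale0r subr0; apply: cone_hull0.
- move=> {}x y [s s0 Dx] [s' s'0 Dy]; exists (s + s'); first exact: addr_ge0.
  by rewrite scalerDl opprD addrACA; apply: cone_hullD.
- move=> a {}x a0 [s s0 Dx]; exists (a * s); first exact: mulr_ge0.
  by rewrite -scalerA -scalerBr; apply: cone_hullZ.
- move=> i j /setU1P[<-|Dij].
    by exists 1 => //=; rewrite scale1r subrr; apply: cone_hull0.
  by exists 0 => //; rewrite scale0r subr0; apply: gcone_root.
Qed.

Lemma gcone_shift D i j s x : gcone D (rootv i j) -> 0 <= s ->
  gcone D x -> gcone D (x + s *: rootv i j).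
Proof. by move=> Dij s0 Dx; apply: cone_hullD => //; apply: cone_hullZ. Qed.

(** The two one-sided extensions meet in [gcone D] and together cover the cone with the whole line,
    so the indicators satisfy inclusion-exclusion. *)
Lemma gcone_split D i j x :
  (`[< gcone D x >] + `[< gcone ((i, j) |: ((j, i) |: D)) x >] =
   `[< gcone ((i, j) |: D) x >] + `[< gcone ((j, i) |: D) x >])%N.
Proof.
have Dij y : gcone D y -> gcone ((i, j) |: D) y by apply/gconeS/subsetUr.
have Dji y : gcone D y -> gcone ((j, i) |: D) y by apply/gconeS/subsetUr.
have Dij2 y : gcone ((i, j) |: D) y -> gcone ((i, j) |: ((j, i) |: D)) y.
  by apply/gconeS/setUS/subsetUr.
have Dji2 y : gcone ((j, i) |: D) y -> gcone ((i, j) |: ((j, i) |: D)) y.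
  by apply/gconeS/subsetUr.
have meet : gcone ((i, j) |: D) x -> gcone ((j, i) |: D) x -> gcone D x.
  move=> /gconeU1P[s s0 /= Dx] /gconeU1P[s' s'0 /= D'x].
  move: s0 s'0; rewrite le0r => /orP[/eqP z _|s0 s'0].
    by move: Dx; rewrite z scale0r subr0.
  have ss' : 0 < s + s' by rewrite ltr_wpDr.
  (* The two points of [gcone D] lie on either side of [x] in the direction of the root; the weights
     [s'] and [s] make the multiples of the root cancel. *)
  have -> : x = (s + s')^-1 *:
     (s' *: (x - s *: rootv i j) + s *: (x - s' *: rootv j i)).
    rewrite -(rootvN i j); move: (rootv i j) => r.
    by apply/rowP => k; rewrite !mxE; field; rewrite gt_eqF.
  apply: cone_hullZ; first by rewrite invr_ge0 ltW.
  by apply: cone_hullD; apply: cone_hullZ => //; apply: ltW.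
have join : gcone ((i, j) |: ((j, i) |: D)) x ->
    gcone ((i, j) |: D) x \/ gcone ((j, i) |: D) x.
  move=> /gconeU1P[s s0 /= /gconeU1P[s' s'0 /= Dx]].
  (* Only the net multiple [s - s'] of the root matters, and its sign selects the side. *)
  have {Dx}: gcone D (x - (s - s') *: rootv i j).
    by move: Dx; rewrite -(rootvN i j) scalerN opprK scalerBl opprB addrA addrAC.
  case: (leP s' s) => ss' Dx; [left | right]; apply/gconeU1P => /=.
    by exists (s - s'); rewrite ?subr_ge0.
  exists (s' - s); first by rewrite subr_ge0 ltW.
  by rewrite -(rootvN i j) scalerN -scaleNr opprB.
case: (asboolP (gcone D x)) => h.
  by rewrite !asboolT //; [apply: Dji | apply: Dij | apply/Dij2/Dij].
case: (asboolP (gcone ((i, j) |: D) x)) => h1.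
  by rewrite asboolT ?asboolF; [| move=> h2; apply/h/meet | apply: Dij2].
case: (asboolP (gcone ((j, i) |: D) x)) => h2.
  by rewrite asboolT //; apply: Dji2.
by rewrite asboolF // => /join[].
Qed.

Lemma gcone_coord D (w : 'I_n) :
  (forall p, p \in D -> p.1 != w /\ p.2 != w) -> forall x, gcone D x -> x 0 w = 0.
Proof.
move=> Dw; apply: gcone_ind.
- by rewrite mxE.
- by move=> x y xw yw; rewrite mxE xw yw addr0.
- by move=> a x _ xw; rewrite mxE xw mulr0.
- move=> i j /Dw /= [iw jw]; rewrite !mxE eqxx /=.
  by rewrite ![w == _]eq_sym (negPf iw) (negPf jw) subrr.
Qed.

End ConeHull.

Arguments gcone R {n} D _.

(** * Sums of formal series *)

Section Sums.
Variable n : nat.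
Implicit Types (S : 'rV[int]_n -> int) (A : {set 'I_n}) (p q : {mpoly int[n]}).
Implicit Types f g : ratfun n.

Lemma tfracM p q : tfrac (p * q) = tfrac p * tfrac q.
Proof. by rewrite /tfrac tofracM. Qed.

Lemma tfracD p q : tfrac (p + q) = tfrac p + tfrac q.
Proof. by rewrite /tfrac tofracD. Qed.

Lemma tfracB p q : tfrac (p - q) = tfrac p - tfrac q.
Proof. by rewrite /tfrac tofracB. Qed.

Lemma tfrac1 : tfrac (1 : {mpoly int[n]}) = 1.
Proof. by rewrite /tfrac tofrac1. Qed.

Lemma tfrac0 : tfrac (0 : {mpoly int[n]}) = 0.
Proof. by rewrite /tfrac tofrac0. Qed.

Lemma tfrac_eq0 p : (tfrac p == 0) = (p == 0).
Proof. by rewrite /tfrac tofrac_eq0. Qed.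

Lemma tfrac_inj : injective (@tfrac n).
Proof. by move=> p q /eqP; rewrite /tfrac tofrac_eq => /eqP. Qed.

Lemma eq_series_mul q S S' : S =1 S' -> series_mul q S =1 series_mul q S'.
Proof. by move=> SS' l; apply: eq_bigr => m _; rewrite SS'. Qed.

Lemma series_mulDr q S S' l :
  series_mul q (fun l => S l + S' l) l = series_mul q S l + series_mul q S' l.
Proof.
by rewrite /series_mul -big_split; apply: eq_bigr => m _; rewrite mulrDr.
Qed.

Lemma series_mulNr q S l : series_mul q (fun l => - S l) l = - series_mul q S l.
Proof.
by rewrite /series_mul -sumrN; apply: eq_bigr => m _; rewrite mulrN.
Qed.

Lemma series_mulX a S l : series_mul 'X_a S l = S (l - delta_mx 0 a).
Proof.
rewrite -[X in series_mul X]scale1r series_mulZX mul1r; congr (S (l - _)).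
by apply/rowP => i; rewrite !mxE eqxx mnm1E eq_sym natz.
Qed.

Lemma series_mul1 S l : series_mul 1 S l = S l.
Proof.
have -> : (1 : {mpoly int[n]}) = 1 *: 'X_[0%MM] by rewrite mpolyX0 scale1r.
rewrite series_mulZX mul1r; congr S.
by apply/rowP => i; rewrite !mxE mnm0E oppr0 addr0.
Qed.

Lemma series_mulNl q S l : series_mul (- q) S l = - series_mul q S l.
Proof.
by apply/eqP; rewrite -addr_eq0 -series_mulD addNr series_mul0.
Qed.

Lemma mpolyXB_neq0 (i j : 'I_n) : i != j -> 'X_i - 'X_j != 0 :> {mpoly int[n]}.
Proof.
move=> ij; rewrite subr_eq0; apply/eqP => /(congr1 (mcoeff U_(i))).
by rewrite !mcoeffX eqxx eq_mnm1 eq_sym (negPf ij).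
Qed.

Definition diff_prod A q := exists2 s : seq ('I_n * 'I_n),
  all (fun d => [&& d.1 != d.2, d.1 \in A & d.2 \in A]) s &
  q = \prod_(d <- s) ('X_d.1 - 'X_d.2).

Lemma diff_prod_neq0 A q : diff_prod A q -> q != 0.
Proof.
case=> s /allP sP ->; rewrite prodf_seq_neq0; apply/allP => d /sP /and3P[d12 _ _].
exact: mpolyXB_neq0.
Qed.

Lemma diff_prod1 A : diff_prod A 1.
Proof. by exists [::] => //; rewrite big_nil. Qed.

Lemma diff_prodM A p q : diff_prod A p -> diff_prod A q -> diff_prod A (p * q).
Proof.
by case=> s sA -> [s' sA' ->]; exists (s ++ s'); rewrite ?all_cat ?sA // big_cat.
Qed.

Lemma diff_prodXB A i j : i != j -> i \in A -> j \in A -> diff_prod A ('X_i - 'X_j).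
Proof. by move=> ij iA jA; exists [:: (i, j)]; rewrite ?big_seq1 //= ij iA jA. Qed.

Lemma diff_prodS A A' q : A \subset A' -> diff_prod A q -> diff_prod A' q.
Proof.
move=> /subsetP AA' [s /allP sA ->]; exists s => //; apply/allP => d /sA.
by case/and3P=> -> /AA' -> /AA' ->.
Qed.

(* Keeping track of the denominators is only needed for the integrality of the
   coefficients of KT. *)
Definition asum A S f := exists p q,
  [/\ diff_prod A q, f = tfrac p / tfrac q
    & forall l, series_mul q S l = series_mul p (@series_one n) l].

Lemma asum_sums_to A S f : asum A S f -> sums_to S f.
Proof. by case=> p [q [/diff_prod_neq0 q0 fE pq]]; exists p, q. Qed.

Lemma asum_Hilb A (R : realFieldType) (C : set 'rV[R]_n) f :
  asum A (hilb_series C) f -> Hilb C = f.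
Proof. by move=> /asum_sums_to /HilbE. Qed.

Lemma asumS A A' S f : A \subset A' -> asum A S f -> asum A' S f.
Proof. by move=> AA' [p [q [/(diff_prodS AA') Aq fE pq]]]; exists p, q. Qed.

Lemma eq_asum A S S' f : S =1 S' -> asum A S f -> asum A S' f.
Proof.
move=> SS' [p [q [Aq fE pq]]]; exists p, q; split=> // l.
by rewrite -(eq_series_mul q SS').
Qed.

Lemma asumD A S S' f f' : asum A S f -> asum A S' f' ->
  asum A (fun l => S l + S' l) (f + f').
Proof.
case=> p [q [Aq -> pq]] [p' [q' [Aq' -> pq']]].
have q0 := diff_prod_neq0 Aq; have q'0 := diff_prod_neq0 Aq'.
exists (p * q' + p' * q), (q * q'); split; first exact: diff_prodM.
  by rewrite tfracD !tfracM addf_div // tfrac_eq0.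
move=> l; rewrite series_mulDr series_mulD; congr (_ + _).
  by rewrite mulrC [p * _]mulrC !series_mulM; apply: eq_series_mul.
by rewrite [p' * _]mulrC !series_mulM; apply: eq_series_mul.
Qed.

Lemma asumN A S f : asum A S f -> asum A (fun l => - S l) (- f).
Proof.
case=> p [q [Aq -> pq]]; exists (- p), q; split=> //.
  by rewrite -mulNr -sub0r -[0]tfrac0 -tfracB sub0r.
by move=> l; rewrite series_mulNr series_mulNl pq.
Qed.

Lemma asumB A S S' f f' : asum A S f -> asum A S' f' ->
  asum A (fun l => S l - S' l) (f - f').
Proof. by move=> Sf /asumN; apply: asumD. Qed.

Lemma asum0 A : asum A (fun=> 0) 0.
Proof.
exists 0, 1; split; [exact: diff_prod1 | by rewrite tfrac0 mul0r |].
by move=> l; rewrite series_mul1 series_mul0.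
Qed.

Lemma asum1 A : asum A (@series_one n) 1.
Proof.
exists 1, 1; split=> //; first exact: diff_prod1.
by rewrite tfrac1 divr1.
Qed.

Lemma asum_sum A (I : eqType) (r : seq I) (S : I -> 'rV[int]_n -> int)
    (f : I -> ratfun n) :
    (forall i, i \in r -> asum A (S i) (f i)) ->
  asum A (fun l => \sum_(i <- r) S i l) (\sum_(i <- r) f i).
Proof.
elim: r => [_|i r IHr Sf].
  by rewrite big_nil; apply: eq_asum (asum0 A) => l; rewrite big_nil.
rewrite big_cons; apply: (@eq_asum _ (fun l => S i l + \sum_(i <- r) S i l)).
  by move=> l; rewrite big_cons.
by apply: asumD; [apply/Sf/mem_head | apply: IHr => j jr; apply/Sf/mem_behead].
Qed.

(** Translation invariance means that ['X_i - 'X_j] annihilates [S]. This gives the value 0 to cones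
    containing a line. *)
Lemma asum_invariant A S i j : i != j -> i \in A -> j \in A ->
  (forall l, S (l - delta_mx 0 i) = S (l - delta_mx 0 j)) -> asum A S 0.
Proof.
move=> ij iA jA Sij; exists 0, ('X_i - 'X_j); split.
- exact: diff_prodXB.
- by rewrite tfrac0 mul0r.
- by move=> l; rewrite series_mulD series_mulNl !series_mulX Sij subrr series_mul0.
Qed.

(** The hypothesis says [('X_i - 'X_j) S' = 'X_i S], as for the product of [S] with the geometric
    series in [t_j / t_i]. *)
Lemma asum_geometric A S S' f i j : i != j -> i \in A -> j \in A ->
    (forall l, S' (l - delta_mx 0 i) - S' (l - delta_mx 0 j) = S (l - delta_mx 0 i)) ->
  asum A S f -> asum A S' (f * (tfrac 'X_i / (tfrac 'X_i - tfrac 'X_j))).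
Proof.
move=> ij iA jA SS' [p [q [Aq -> pq]]].
exists ('X_i * p), (q * ('X_i - 'X_j)); split.
- by apply/diff_prodM/diff_prodXB.
- by rewrite mulf_div !tfracM tfracB [tfrac p * _]mulrC.
- move=> l; rewrite series_mulM.
  rewrite (@eq_series_mul _ _ (series_mul 'X_i S)); last first.
    by move=> k; rewrite series_mulD series_mulNl !series_mulX SS'.
  by rewrite -series_mulM mulrC !series_mulM; apply: eq_series_mul.
Qed.

End Sums.

(** * Brion decomposition of root cones *)

Section ConeSums.
Variables (R : realFieldType) (n : nat).
Implicit Types (D : {set 'I_n * 'I_n}) (A : {set 'I_n}) (f : ratfun n).

Let rv (l : 'rV[int]_n) : 'rV[R]_n := map_mx (fun z : int => z%:~R) l.

Definition hgcone D := hilb_series (gcone R D).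

Lemma eq_hgcone D D' : gcone R D = gcone R D' -> hgcone D = hgcone D'.
Proof. by rewrite /hgcone => ->. Qed.

Lemma map_intrB_delta (l : 'rV[int]_n) i :
  map_mx (fun z : int => z%:~R) (l - delta_mx 0 i) = rv l - delta_mx 0 i :> 'rV[R]_n.
Proof. by apply/rowP => j; rewrite !mxE rmorphB /= natz. Qed.

Lemma asum_line A D i j : i != j -> i \in A -> j \in A ->
  gcone R D (rootv R i j) -> gcone R D (rootv R j i) -> asum A (hgcone D) 0.
Proof.
move=> ij iA jA Dij Dji; apply: (asum_invariant ij iA jA) => l.
rewrite /hgcone /hilb_series !map_intrB_delta; congr (nat_of_bool _)%:R.
apply: asbool_equiv_eq; split=> Dl.
  rewrite (_ : _ - _ = rv l - delta_mx 0 i + 1 *: rootv R j i); last first.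
    by rewrite scale1r /rootv addrA subrK.
  exact: gcone_shift.
rewrite (_ : _ - _ = rv l - delta_mx 0 j + 1 *: rootv R i j); last first.
  by rewrite scale1r /rootv addrA subrK.
exact: gcone_shift.
Qed.

(** By [gcone_split] the combination is the indicator of a cone that contains the line spanned by
    [rootv R i j]. *)
Lemma asum_split A D i j : i != j -> i \in A -> j \in A ->
  asum A (fun l => hgcone ((i, j) |: D) l + hgcone ((j, i) |: D) l - hgcone D l) 0.
Proof.
move=> ij iA jA.
apply: (@eq_asum _ _ (hgcone ((i, j) |: ((j, i) |: D)))).
  move=> l; apply/eqP; rewrite eq_sym subr_eq [X in _ == X]addrC; apply/eqP.
  by rewrite /hgcone /hilb_series -!natrD gcone_split.
by apply: (asum_line ij) => //; apply: gcone_root; rewrite !inE eqxx ?orbT.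
Qed.

(* The edge from k to i, reversed if s is false, so that sources and sinks can be
   treated together. *)
Definition edge (s : bool) (k i : 'I_n) := if s then (k, i) else (i, k).

Definition star s (I : {set 'I_n}) i := [set edge s k i | k in I].

Lemma starP s (I : {set _}) i p :
  reflect (exists2 k, k \in I & p = edge s k i) (p \in star s I i).
Proof. exact: imsetP. Qed.

Definition rootp (p : 'I_n * 'I_n) := rootv R p.1 p.2.

Lemma rootp_trans s D a b c :
  gcone R D (rootp (edge s a b)) -> gcone R D (rootp (edge s b c)) ->
  gcone R D (rootp (edge s a c)).
Proof.
by case: s => /= ab bc; [apply: gcone_trans ab bc | apply: gcone_trans bc ab].
Qed.

Lemma rootp_mem D p : p \in D -> gcone R D (rootp p).
Proof. by case: p => i j; apply: gcone_root. Qed.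

Lemma rootp_xx s D a : gcone R D (rootp (edge s a a)).
Proof. by rewrite /edge if_same; apply: gcone_xx. Qed.

Lemma gcone_eq_rootp D D' :
    (forall p, p \in D -> gcone R D' (rootp p)) ->
    (forall p, p \in D' -> gcone R D (rootp p)) ->
  gcone R D = gcone R D'.
Proof. by move=> h h'; apply: gcone_eq => i j; [apply: h | apply: h']. Qed.

Lemma star_cons s a (I : seq 'I_n) i :
  star s [set x in a :: I] i = edge s a i |: star s [set x in I] i.
Proof. by rewrite /star set_cons imsetU1. Qed.

(* Brion's theorem for the convex hull of the e_k, k in I, plus a cone: modulo
   cones with a line, the cone is the sum of the tangent cones at the e_i. *)
Lemma asum_star_seq A s (I : seq 'I_n) D : uniq I -> I != [::] -> {subset I <= A} ->
  asum A (fun l => hgcone D l - \sum_(i <- I) hgcone (D :|: star s [set x in I] i) l) 0.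
Proof.
elim: I D => // a I IHI D /= /andP[aI uI] _ IA.
have aA : a \in A by apply/IA/mem_head.
have {}IA : {subset I <= A} by move=> x xI; apply/IA/mem_behead.
have [->|I0] := eqVneq I [::].
  apply: eq_asum (asum0 A) => l; rewrite big_seq1 (@eq_hgcone _ D) ?subrr //.
  apply: gcone_eq_rootp => p; last by move=> pD; apply/rootp_mem/setUP; left.
  case/setUP=> [/rootp_mem//|/starP[k]]; rewrite !inE => /eqP-> ->.
  exact: rootp_xx.
pose T i := D :|: star s [set x in a :: I] i.
pose U i := edge s i a |: (D :|: star s [set x in I] i).
have TE i : T i = edge s a i |: (D :|: star s [set x in I] i).
  by rewrite /T star_cons setUCA.
(* The root between [k] and [a] is the sum of those between [k] and [i] and between [i] and [a].
   Once the star at [i] is present, the star at [a] reduces to the edge between [i] and [a]. *)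
have UE i : i \in I -> hgcone (T a :|: star s [set x in I] i) = hgcone (U i).
  move=> iI; apply/eq_hgcone/gcone_eq_rootp => p.
    case/setUP=> [/setUP[pD|/starP[k]]|pI].
    - by apply/rootp_mem; rewrite !inE pD orbT.
    - rewrite !inE => /predU1P[->|kI] ->; first exact: rootp_xx.
      apply: (@rootp_trans _ _ _ i); apply: rootp_mem; rewrite !inE ?eqxx //.
      by apply/orP; right; apply/orP; right; apply/starP; exists k; rewrite ?inE.
    - by apply: rootp_mem; rewrite !inE pI !orbT.
  case/setU1P=> [->|/setUP[pD|pI]]; apply/rootp_mem; rewrite !inE.
  - apply/orP; left; apply/orP; right; apply/starP; exists i => //.
    by rewrite !inE iI orbT.
  - by rewrite pD.
  - by rewrite pI !orbT.
(* [h1] expands [D] over [I], [h2] expands [T a] over [I], and [h3] splits each cone of [h1] along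
   the edge between [i] and [a]. In [h1 - h2 - h3] the cones of [U i] and the stars on [I] alone
   cancel. *)
have h1 := IHI D uI I0 IA.
have h2 := IHI (T a) uI I0 IA.
have h3 i : i \in I -> asum A (fun l => hgcone (T i) l + hgcone (U i) l -
    hgcone (D :|: star s [set x in I] i) l) 0.
  move=> iI; have ia : i != a by apply: contraNneq aI => <-.
  have := asum_split (D :|: star s [set x in I] i) ia (IA _ iI) aA.
  rewrite TE /U /edge; case: (s) => //.
  by apply: eq_asum => l; congr (_ - _); rewrite addrC.
have {}h3 := asum_sum h3; rewrite big1_eq in h3.
have := asumB (asumB h1 h2) h3; rewrite !subr0; apply: eq_asum => l.
rewrite big_cons !sumrB !big_split /=.
have -> : \sum_(i <- I) hgcone (T a :|: star s [set x in I] i) l =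
    \sum_(i <- I) hgcone (U i) l by apply: eq_big_seq => i /UE->.
by rewrite -/(T a); set x := hgcone D l; ring.
Qed.

End ConeSums.

(** * Existence and expansions of the Hilbert series of root cones *)

Section ConeExistence.
Variables (R : realFieldType) (n : nat).
Implicit Types (D : {set 'I_n * 'I_n}) (A I : {set 'I_n}) (f : ratfun n).
Local Notation hgcone := (hgcone R).
Local Notation rootp := (rootp R).

Lemma asum_star A s I D (f : 'I_n -> ratfun n) : I != set0 -> I \subset A ->
    (forall i, i \in I -> asum A (hgcone (D :|: star s I i)) (f i)) ->
  asum A (hgcone D) (\sum_(i in I) f i).
Proof.
move=> I0 /subsetP IA If.
have eI : [set x in enum I] = I by apply/setP => x; rewrite inE mem_enum.
have h : enum I != [::].
  by apply: contra_neq I0 => e; rewrite -eI e; apply/setP => x; rewrite !inE.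
have IA' : {subset enum I <= A} by move=> x; rewrite mem_enum; apply: IA.
have h1 := asum_star_seq R s D (enum_uniq I) h IA'.
have h2 i : i \in enum I -> asum A (hgcone (D :|: star s I i)) (f i).
  by rewrite mem_enum; apply: If.
have := asumD h1 (asum_sum h2); rewrite add0r big_enum; apply: eq_asum => l.
by rewrite eI subrK.
Qed.

Definition edge_coef s (i w : 'I_n) : ratfun n :=
  let p := edge s i w in tfrac 'X_p.1 / (tfrac 'X_p.1 - tfrac 'X_p.2).

Definition avoids w D := [forall p in D, (p.1 != w) && (p.2 != w)].

(** No generator in [D] involves [w], while the new root has [w]-coordinate 1 or -1. So a lattice
    point of the new cone is uniquely a natural multiple of this root plus a lattice point of
    [gcone R D], and the series acquires a geometric factor. *)
Lemma asum_edge A D w i s f : avoids w D -> i != w -> i \in A -> w \in A ->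
  asum A (hgcone D) f -> asum A (hgcone (edge s i w |: D)) (f * edge_coef s i w).
Proof.
move=> /forall_inP Dw iw iA wA.
have {}Dw p : p \in D -> p.1 != w /\ p.2 != w by move=> /Dw/andP.
(* [z] is the [w]-coordinate of the new root [r]; subtracting [z * y_w] times [r] projects [y] along
   [r] to the hyperplane [y_w = 0]. *)
pose z : int := if s then 1 else -1.
have [r rE] : exists r, r = rootp (edge s i w) by exists (rootp (edge s i w)).
have rw : r 0 w = z%:~R.
  rewrite rE /rootp /rootv /z /edge; case: (s); rewrite !mxE !eqxx /=;
  by rewrite eq_sym (negPf iw) ?subr0 ?sub0r // rmorphN.
have zz : z * z = 1 by rewrite /z; case: (s).
have zzR : z%:~R * z%:~R = 1 :> R by rewrite -intrM zz.
have XE y : gcone R (edge s i w |: D) y <->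
    0 <= z%:~R * y 0 w /\ gcone R D (y - (z%:~R * y 0 w) *: r).
  rewrite gconeU1P -/(rootp _) -rE; split=> [[t t0 Dy]|[]]; last first.
    by move=> h Dy; exists (z%:~R * y 0 w).
  have := gcone_coord Dw Dy; rewrite !mxE rw => /eqP; rewrite subr_eq0 => /eqP ->.
  by rewrite mulrCA zzR mulr1.
(* Both indicators on the left test the same projection, under the conditions [0 <= z * c] and
   [1 <= z * c]. They differ only at [c = 0], where the projection is [y] itself. *)
have key (y : 'rV[R]_n) (c : int) : y 0 w = c%:~R ->
    `[< gcone R (edge s i w |: D) y >]%:R
      - `[< gcone R (edge s i w |: D) (y - r) >]%:R = `[< gcone R D y >]%:R :> int.
  move=> yw; have ywr : (y - r) 0 w = (c - z)%:~R by rewrite !mxE yw rw rmorphB.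
  have -> : `[< gcone R (edge s i w |: D) y >] =
      (0 <= z * c) && `[< gcone R D (y - (z * c)%:~R *: r) >].
    apply/asboolP/andP; rewrite XE yw -intrM ler0z => -[h1 h2]; split=> //.
      exact/asboolP.
    exact/asboolP.
  have -> : `[< gcone R (edge s i w |: D) (y - r) >] =
      (1 <= z * c) && `[< gcone R D (y - (z * c)%:~R *: r) >].
    have e : y - r - (z * (c - z))%:~R *: r = y - (z * c)%:~R *: r.
      by rewrite mulrBr zz rmorphB /= scalerBl scale1r opprB addrA subrK.
    apply/asboolP/andP; rewrite XE ywr -intrM ler0z e mulrBr zz subr_ge0 => -[h1 h2].
      by split=> //; apply/asboolP.
    by split=> //; apply/asboolP.
  have [c0|c0] := eqVneq c 0.
    by rewrite c0 mulr0 /= scale0r subr0 subr0.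
  rewrite (_ : `[< gcone R D y >] = false); last first.
    apply/asboolP => /(gcone_coord Dw); rewrite yw => /eqP.
    by rewrite intr_eq0 (negPf c0).
  rewrite (_ : (0 <= z * c) = (1 <= z * c)) ?subrr //.
  by rewrite /z; case: (s); lia.
rewrite /edge_coef; move: (erefl (edge s i w)).
case: {-1}(edge s i w) => a b eab /=.
have [ab aA bA] : [/\ a != b, a \in A & b \in A].
  by move: eab; rewrite /edge; case: (s) => -[<- <-]; rewrite // eq_sym.
apply: asum_geometric => // l.
rewrite /hgcone /hilb_series !map_intrB_delta -eab.
rewrite -(key _ ((l - delta_mx 0 a) 0 w)); last first.
  by rewrite -map_intrB_delta mxE.
by rewrite rE /rootp eab /rootv /= opprB addrA subrK.
Qed.

Lemma asum_loops A D : (forall p, p \in D -> p.1 = p.2) -> asum A (hgcone D) 1.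
Proof.
move=> Dl; apply: eq_asum (asum1 A) => l.
rewrite /hgcone /hilb_series /series_one; congr (nat_of_bool _)%:R.
apply/eqP/asboolP => [->|Dx].
  rewrite (_ : map_mx _ _ = 0); first exact: cone_hull0.
  by apply/rowP => i; rewrite !mxE.
have x0 (x : 'rV[R]_n) : gcone R D x -> x = 0.
  move: x; apply: gcone_ind => //.
  - by move=> x y -> ->; rewrite addr0.
  - by move=> a x _ ->; rewrite scaler0.
  - by move=> i j /Dl /= ->; rewrite rootvv.
apply/rowP => i; move/x0/rowP/(_ i): Dx; rewrite !mxE => /eqP.
by rewrite intr_eq0 => /eqP.
Qed.

(** Induction on [#|A|], using the star expansion twice: first all roots into some [i] are added,
    then all roots into some [j] from the elements other than [i]. Either a root leaves [i] and the
    cone contains a line, or [i] is reached through [j] only; then the edge from [j] to [i] splits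
    off a cone on [A :\ i]. *)
Lemma asum_gcone A D : (forall p, p \in D -> p.1 \in A /\ p.2 \in A) ->
  asum A (hgcone D) (Hilb (gcone R D)).
Proof.
have [m] := ubnP #|A|; elim: m A D => // m IHm A D Am DA.
have ok f : asum A (hgcone D) f -> asum A (hgcone D) (Hilb (gcone R D)).
  by move=> Df; rewrite (asum_Hilb Df).
have [A0|A0] := eqVneq A set0.
  by apply/ok/asum_loops => p /DA; rewrite A0 inE => -[].
apply/ok/(@asum_star _ true A _ (fun i => Hilb (gcone R (D :|: star true A i)))) => //.
move=> i iA; set T := D :|: star true A i.
have {}ok f : asum A (hgcone T) f -> asum A (hgcone T) (Hilb (gcone R T)).
  by move=> Df; rewrite (asum_Hilb Df).
have Tki k : k \in A -> (k, i) \in T.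
  by move=> kA; rewrite inE; apply/orP; right; apply/starP; exists k.
case: (boolP [exists o, (o != i) && ((i, o) \in D)]) => [/existsP[o /andP[oi Do]]|].
  have [_ /= oA] := DA _ Do.
  apply/ok/(@asum_line _ _ _ _ i o) => //; first by rewrite eq_sym.
    by apply: gcone_root; rewrite inE Do.
  exact/gcone_root/Tki.
move=> /existsPn no.
have {}no o : (i, o) \in D -> o = i.
  by move=> Do; apply/eqP; move: (no o); rewrite Do andbT negbK.
have [A'0|A'0] := eqVneq (A :\ i) set0.
  have {}A'0 k : k \in A -> k = i.
    by move=> kA; apply/eqP; move/setP/(_ k): A'0; rewrite !inE kA andbT => /negbFE.
  apply/ok/asum_loops => p /setUP[/DA[/A'0 -> /A'0 ->] //|].
  by move=> /starP[k /A'0 -> ->].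
apply/ok/(@asum_star _ true (A :\ i) _
    (fun j => Hilb (gcone R (T :|: star true (A :\ i) j)))) => //.
  exact: subsetDl.
move=> j /setD1P[ji jA]; set T2 := T :|: _.
(* At this point no root of [D] leaves [i] except a loop. The roots entering [i] are dropped, since
   each factors through [j]. *)
pose D2 := [set p in D | (p.1 != i) && (p.2 != i)] :|: star true (A :\ i) j.
have D2w : avoids i D2.
  apply/forall_inP => p /setUP[|/starP[k]]; rewrite !inE => /andP[] // ki _ ->.
  by rewrite /= ki ji.
have T2E : gcone R T2 = gcone R (edge true j i |: D2).
  apply: gcone_eq_rootp => p.
    have ki k : k \in A -> gcone R (edge true j i |: D2) (rootp (edge true k i)).
      have [->|ki kA] := eqVneq k i; first by move=> _; apply: rootp_xx.
      apply: (rootp_trans (b := j)); apply: rootp_mem; rewrite !inE ?eqxx //.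
      by apply/orP; right; apply/orP; right; apply/starP; exists k; rewrite // !inE ki.
    case/setUP => [/setUP[pD|/starP[k kA ->]]|pI]; last 2 first.
    - exact: ki.
    - by apply: rootp_mem; rewrite !inE pI !orbT.
    have [pA1 pA2] := DA _ pD; move: pA1 pA2 pD; case: p => k k' /= kA k'A pD.
    have [k'i|k'i] := eqVneq k' i; first by rewrite k'i; apply: ki.
    have [ki'|ki'] := eqVneq k i; first by case/eqP: k'i; apply: no; rewrite -ki'.
    by apply: rootp_mem; rewrite !inE /= pD ki' k'i orbT.
  case/setU1P => [->|/setUP[pD|pI]]; apply/rootp_mem; rewrite !inE.
  - by have := Tki j jA; rewrite inE => ->.
  - by move: pD; rewrite inE => /andP[->].
  - by rewrite pI !orbT.
have D2A p : p \in D2 -> p.1 \in A :\ i /\ p.2 \in A :\ i.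
  case/setUP => [|/starP[k kA ->]]; last by rewrite /= kA !inE ji jA.
  by rewrite !inE => /andP[/DA[-> ->] /andP[-> ->]].
have Ai : (#|A :\ i| < m)%N by move: Am; rewrite (cardsD1 i) iA.
have := asum_edge true D2w ji jA iA (asumS (subsetDl _ _) (IHm _ _ Ai D2A)).
by rewrite -(eq_hgcone T2E) => h; rewrite (asum_Hilb h).
Qed.

Lemma Hilb_star s I D : I != set0 ->
  Hilb (gcone R D) = \sum_(i in I) Hilb (gcone R (D :|: star s I i)).
Proof.
move=> I0; apply: (asum_Hilb (A := setT)); apply: (asum_star I0 (subsetT _)).
by move=> i _; apply: asum_gcone => p _; rewrite !inE.
Qed.

(** In the summand at [i] every root between [k] and [w] factors through [i]. Of the star at [w]
    only the edge joining [i] and [w] remains, and [asum_edge] turns it into a factor. *)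
Lemma Hilb_star_edge s I D w : I != set0 -> w \notin I -> avoids w D ->
  Hilb (gcone R (D :|: star s I w)) =
  \sum_(i in I) Hilb (gcone R (D :|: star s I i)) * edge_coef s i w.
Proof.
move=> I0 wI Dw; rewrite (@Hilb_star s I) //; apply: eq_bigr => i iI.
have iw : i != w by apply: contraNneq wI => <-.
rewrite (_ : gcone R (D :|: star s I w :|: _) =
    gcone R (edge s i w |: (D :|: star s I i))).
  apply: (asum_Hilb (A := setT)); apply: asum_edge; rewrite ?inE //.
    apply/forall_inP => p /setUP[pD|/starP[k kI ->]]; first exact: (forall_inP Dw).
    have kw : k != w by apply: contraNneq wI => <-.
    by rewrite /edge; case: (s); rewrite /= kw iw.
  by apply: asum_gcone => p _; rewrite !inE.
apply: gcone_eq_rootp => p.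
  case/setUP => [/setUP[pD|/starP[k kI ->]]|pI].
  - by apply: rootp_mem; rewrite !inE pD orbT.
  - apply: (rootp_trans (b := i)); apply: rootp_mem; rewrite !inE ?eqxx //.
    by apply/orP; right; apply/orP; right; apply/starP; exists k.
  - by apply: rootp_mem; rewrite !inE pI !orbT.
case/setU1P => [->|/setUP[pD|pI]]; apply/rootp_mem; rewrite !inE ?pD ?pI ?orbT //.
by apply/orP; left; apply/orP; right; apply/starP; exists i.
Qed.

End ConeExistence.

(** * Exchange of bases *)

Ltac rank_lia := repeat match goal with
  | |- context [rk ?M ?X] => move: (rk M X) => ?
  | |- context [mrank ?M] => move: (mrank M) => ?
  | |- context [#|?X|] => move: #|X| => ?
  end; clear; lia.

Section MatroidBases.
Variables (n : nat) (M : matroid n).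
Implicit Types (A B X Y : {set 'I_n}) (a b p q : 'I_n).

Lemma rk_le_mrank X : (M X <= mrank M)%N.
Proof. exact/rk_mono/subsetT. Qed.

Lemma basisP B : reflect (#|B| = mrank M /\ M B = mrank M) (is_basis M B).
Proof.
rewrite /is_basis; apply: (iffP andP) => [[/eqP h /eqP h']|[h h']].
  by rewrite -h h'.
by rewrite h h' !eqxx.
Qed.

Lemma rk_setU1 a X : (M (a |: X) <= (M X).+1)%N.
Proof.
have := rk_submod M [set a] X; have := rk_le_card M [set a]; rewrite cards1.
rank_lia.
Qed.

Lemma rk_sub_basis B X : is_basis M B -> X \subset B -> M X = #|X|.
Proof.
move=> /basisP[cB rB] XB; apply/eqP; rewrite eqn_leq rk_le_card /=.
have := rk_submod M X (B :\: X); rewrite -{1}(setIidPr XB) setID.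
have := rk_le_card M (B :\: X); rewrite cardsD (setIidPr XB) cB -rB.
have := subset_leq_card XB; rewrite cB -rB; rank_lia.
Qed.

Lemma rk_setU_closure X Z : (forall a, a \in X -> M (a |: Z) = M Z) -> M (X :|: Z) = M Z.
Proof.
have [m] := ubnP #|X|; elim: m X => // m IHm X Xm XZ.
have [->|[a aX]] := set_0Vmem X; first by rewrite set0U.
have Xa : M ((X :\ a) :|: Z) = M Z.
  apply: IHm => [|b /setD1P[_]]; last exact: XZ.
  by move: Xm; rewrite (cardsD1 a) aX.
have := rk_submod M ((X :\ a) :|: Z) (a |: Z); rewrite Xa XZ //.
rewrite (_ : _ :|: (a |: Z) = X :|: Z); last first.
  by rewrite setUACA setUid (setUC (X :\ a)) setD1K.
have : (M Z <= M (((X :\ a) :|: Z) :&: (a |: Z)))%N.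
  by apply: rk_mono; rewrite subsetI !subsetUr.
have : (M Z <= M (X :|: Z))%N by apply/rk_mono/subsetUr.
rank_lia.
Qed.

Lemma card_exchange B a b : a \in B -> b \notin B -> #|b |: B :\ a| = #|B|.
Proof. by move=> aB bB; rewrite cardsU1 !inE (negPf bB) andbF (cardsD1 a B) aB. Qed.

(** [X] is a minimal subset of [B] spanning [b], that is, the fundamental circuit of [b] with [b]
    removed. *)
Lemma exchange_circuit B b : is_basis M B -> b \notin B ->
  exists X : {set 'I_n}, [/\ X \subset B, M (b |: X) = M X
    & forall a, a \in X -> is_basis M (b |: B :\ a)].
Proof.
move=> bB b2; have /basisP[cB rB] := bB.
pose P X := (X \subset B) && (M (b |: X) == M X).
have PB : P B.
  rewrite /P subxx /= eqn_leq rB rk_le_mrank -rB rk_mono //; exact: subsetUr.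
have [X /minsetP[/andP[XB /eqP bX] minX] _] := minset_exists PB.
exists X; split=> // a aX; have aB := subsetP XB _ aX; apply/negPn/negP => nb.
(* If exchanging [a] for [b] fails, then [b] is spanned by [X] and by [B :\ a]; submodularity puts
   it in the span of [X :\ a], against minimality. *)
suff: P (X :\ a).
  by move/minX => /(_ (subsetDl _ _))/setP/(_ a); rewrite !inE eqxx aX.
have YB : X :\ a \subset B by apply: subset_trans (subsetDl _ _) XB.
have BaB : B :\ a \subset B by apply: subsetDl.
have r1 : M (b |: B :\ a) = #|B :\ a|.
  have c1 := card_exchange aB b2.
  have : M (b |: B :\ a) != mrank M.
    by apply: contra nb => /eqP h; apply/basisP; rewrite c1 cB.
  have := rk_le_mrank (b |: B :\ a).
  have : (M (B :\ a) <= M (b |: B :\ a))%N by apply/rk_mono/subsetUr.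
  rewrite (rk_sub_basis bB BaB) -cB (cardsD1 a B) aB; rank_lia.
have := rk_submod M (b |: X) (b |: B :\ a).
have -> : (b |: X) :|: (b |: B :\ a) = b |: B.
  rewrite setUACA setUid; congr (_ |: _); apply/setP => z; rewrite !inE.
  have [->|_] := eqVneq z a; first by rewrite aX aB.
  by apply/orP/idP => [[/(subsetP XB)|]|->]; auto.
have -> : (b |: X) :&: (b |: B :\ a) = b |: X :\ a.
  rewrite -setUIr; congr (_ |: _); apply/setP => z; rewrite !inE.
  by case: eqVneq => //= _; rewrite ?andbF // andb_idr // => /(subsetP XB).
have : (M B <= M (b |: B))%N by apply/rk_mono/subsetUr.
have h : (M (X :\ a) <= M (b |: X :\ a))%N by apply/rk_mono/subsetUr.
rewrite /P YB eqn_leq h andbT; move: h.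
rewrite r1 bX (rk_sub_basis bB XB) (rk_sub_basis bB YB) rB -cB.
rewrite (cardsD1 a X) aX (cardsD1 a B) aB; rank_lia.
Qed.

(** Some element [a] of the fundamental circuit of [b] over [B] lies outside the span of [B' :\ b]:
    otherwise [b], spanned by the rest of its circuit, would lie in that span, and [B'] would be
    dependent. *)
Lemma sym_exchange B B' b : is_basis M B -> is_basis M B' ->
    b \in B' -> b \notin B ->
  exists a, [/\ a \in B, a \notin B', is_basis M (b |: B :\ a)
    & is_basis M (a |: B' :\ b)].
Proof.
move=> bB bB' b1 b2; have [X [XB bX XA]] := exchange_circuit bB b2.
have /basisP[cB rB] := bB; have /basisP[cB' rB'] := bB'.
have BbB' : B' :\ b \subset B' by apply: subsetDl.
have [a aX ra] : exists2 a, a \in X & M (a |: B' :\ b) != M (B' :\ b).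
  apply/exists_inP; apply: contraT => /exists_inPn h.
  have {}h a : a \in X -> M (a |: B' :\ b) = M (B' :\ b).
    by move=> /h; rewrite negbK => /eqP.
  have := rk_submod M (X :|: (B' :\ b)) (b |: X); rewrite (rk_setU_closure h) bX.
  have : (mrank M <= M ((X :|: (B' :\ b)) :|: (b |: X)))%N.
    rewrite -rB'; apply: rk_mono; apply/subsetP => z zB'; rewrite !inE zB'.
    by case: eqVneq; rewrite ?orbT.
  have : (M X <= M ((X :|: (B' :\ b)) :&: (b |: X)))%N.
    by apply: rk_mono; rewrite subsetI subsetUl subsetUr.
  rewrite (rk_sub_basis bB' BbB') -cB' (cardsD1 b B') b1; rank_lia.
have aB := subsetP XB _ aX.
have ab : a != b by apply: contraNneq b2 => <-.
have aB' : a \notin B'.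
  apply: contraNN ra => aB'; rewrite (_ : a |: _ = B' :\ b) //.
  by apply/setUidPr; rewrite sub1set !inE ab.
exists a; split=> //; first exact: XA.
apply/basisP; split; first by rewrite card_exchange.
have := rk_le_mrank (a |: B' :\ b).
have : (M (B' :\ b) <= M (a |: B' :\ b))%N by apply/rk_mono/subsetUr.
move: ra; rewrite (rk_sub_basis bB' BbB') -cB' (cardsD1 b B') b1; rank_lia.
Qed.

(* In the contraction by A, of rank 2, b and q are parallel. *)
Lemma parallel_exchange A a b p q :
    [&& a \notin A, b \notin A, p \notin A & q \notin A] ->
    [&& a != b, a != p, a != q, b != p, b != q & p != q] ->
    is_basis M (a |: (p |: A)) -> is_basis M (a |: (q |: A)) ->
    is_basis M (b |: (p |: A)) -> ~~ is_basis M (b |: (q |: A)) ->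
  is_basis M (a |: (b |: A)) /\ is_basis M (p |: (q |: A)).
Proof.
move=> /and4P[aA bA pA qA] /and5P[ab ap aq bp /andP[bq pq]].
have card2 c d : c \notin A -> d \notin A -> c != d -> #|c |: (d |: A)| = #|A|.+2.
  by move=> cA dA cd; rewrite !cardsU1 !inE (negPf cd) (negPf cA) dA.
have basis2 c d : c \notin A -> d \notin A -> c != d ->
    is_basis M (c |: (d |: A)) = (#|A|.+2 == mrank M) && (M (c |: (d |: A)) == mrank M).
  move=> cA dA cd; apply/basisP/andP; rewrite card2 //; first by case=> -> ->.
  by case=> /eqP -> /eqP ->.
move=> Bap; have /basisP[] := Bap; rewrite card2 // => cA rap.
rewrite !basis2 // cA eqxx /= => /eqP raq /eqP rbp rbq.
have rb : M (b |: A) = #|A|.+1.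
  rewrite (@rk_sub_basis (b |: (p |: A))); first by rewrite cardsU1 bA.
    by rewrite basis2 // cA rbp !eqxx.
  by rewrite setUS // subsetUr.
have rq : M (q |: A) = #|A|.+1.
  rewrite (@rk_sub_basis (a |: (q |: A))); first by rewrite cardsU1 qA.
    by rewrite basis2 // cA raq !eqxx.
  by rewrite subsetUr.
have {}rbq : M (b |: (q |: A)) = #|A|.+1.
  have := rk_le_mrank (b |: (q |: A)); have := rk_setU1 b (q |: A).
  have : (M (q |: A) <= M (b |: (q |: A)))%N by apply/rk_mono/subsetUr.
  by move: rbq; rewrite rq -cA; rank_lia.
split; rewrite eqn_leq rk_le_mrank /=.
  have := rk_submod M (a |: (b |: A)) (b |: (q |: A)).
  have : (M (b |: A) <= M ((a |: (b |: A)) :&: (b |: (q |: A))))%N.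
    by apply: rk_mono; rewrite subsetI subsetUr setUS // subsetUr.
  have : (mrank M <= M ((a |: (b |: A)) :|: (b |: (q |: A))))%N.
    rewrite -raq; apply: rk_mono; apply/subsetP => z; rewrite !inE.
    by move=> /or3P[] ->; rewrite ?orbT.
  by rewrite rbq rb -cA; rank_lia.
have := rk_submod M (p |: (q |: A)) (b |: (q |: A)).
have : (M (q |: A) <= M ((p |: (q |: A)) :&: (b |: (q |: A))))%N.
  by apply: rk_mono; rewrite subsetI !subsetUr.
have : (mrank M <= M ((p |: (q |: A)) :|: (b |: (q |: A))))%N.
  rewrite -rbp; apply: rk_mono; apply/subsetP => z; rewrite !inE.
  by move=> /or3P[] ->; rewrite ?orbT.
by rewrite rbq rq -cA; rank_lia.
Qed.

(** These pairs index the directions [rootv a b] of the edges of the matroid polytope at the vertex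
    of [B]. *)
Definition exch B :=
  [set p | [&& p.1 \in B, p.2 \notin B & is_basis M (p.2 |: B :\ p.1)]].

Variable R : realFieldType.

Lemma indic_exchange B a b : a \in B -> b \notin B ->
  indic_vec R (b |: B :\ a) = indic_vec R B + rootv R a b.
Proof.
move=> aB bB; have ab : a != b by apply: contraNneq bB => <-.
apply/rowP => i; rewrite !mxE !inE eqxx /=.
have [->|ia] := eqVneq i a; first by rewrite aB (negPf ab) /=; lra.
have [->|ib] := eqVneq i b; first by rewrite (negPf bB) /=; lra.
by rewrite /= subr0 addr0.
Qed.

(** Symmetric exchange serves twice: it makes [rootv R a b] a generator at [B], and subtracting this
    root from the vector of [B'] leaves that of a basis with fewer elements outside [B]. *)
Lemma basis_gcone B B' : is_basis M B -> is_basis M B' ->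
  gcone R (exch B) (indic_vec R B' - indic_vec R B).
Proof.
move=> bB; have [m] := ubnP #|B' :\: B|; elim: m B' => // m IHm B' B'm bB'.
have [B'B|[b]] := set_0Vmem (B' :\: B).
  have /eqP -> : B' == B.
    rewrite eqEcard -setD_eq0 B'B eqxx.
    by have /basisP[-> _] := bB; have /basisP[-> _] := bB'; rewrite leqnn.
  by rewrite subrr; apply: cone_hull0.
rewrite inE => /andP[bnB bB'1].
have [a [aB aB' bex bB'']] := sym_exchange bB bB' bB'1 bnB.
have -> : indic_vec R B' = indic_vec R (a |: B' :\ b) + rootv R a b.
  by rewrite indic_exchange // -(rootvN R b a) addrK.
rewrite addrAC addrC; apply: cone_hullD.
  by apply: gcone_root; rewrite !inE aB bnB.
apply: IHm => //; apply: leq_trans (_ : #|B' :\: B| <= m)%N => //.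
apply/proper_card/properP; split.
  apply/subsetP => z; rewrite !inE => /andP[zB /orP[/eqP za|/andP[_ ->]]].
    by rewrite za aB in zB.
  by rewrite zB.
exists b; first by rewrite inE bnB.
by rewrite !inE bnB eqxx /= orbF; apply: contraNneq bnB => ->.
Qed.

End MatroidBases.

Lemma neqP (T : eqType) (x y : T) : x != y -> ((x == y) = false) * ((y == x) = false).
Proof. by move=> xy; split; last rewrite eq_sym; apply: negPf. Qed.

Ltac set_case F z y :=
  case: (eqVneq z y) => [->|_]; first by rewrite ?(F, eqxx, orbT, andbF, andbT) /=.
Ltac set_dec F a b c d :=
  let z := fresh "z" in apply/setP => z; rewrite !inE;
  set_case F z a; set_case F z b; set_case F z c; set_case F z d; done.

(** * Cones of a matroid at two adjacent bases *)

Section AdjacentBases.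
Variables (R : realFieldType) (n : nat) (M : matroid n) (e : 'I_n).
Implicit Types (B : {set 'I_n}) (x : 'I_n) (D : {set 'I_n * 'I_n}).

(** The membership of [e] in [B] decides the direction of the exchange, so that bases with and
    without [e] are treated alike. *)
Definition swap B x := if e \in B then x |: B :\ e else e |: B :\ x.

Definition nbrs B :=
  [set x | [&& x != e, (x \in B) != (e \in B) & is_basis M (swap B x)]].

Definition drop_edges D := [set p in D | (p.1 != e) && (p.2 != e)].

(* The cone of the edges from B and from B' is the cone of the slice of 2Q(M) at
   x_e = 1 at the midpoint of the edge from e_B to e_B'. *)
Definition slice_edges B B' := drop_edges (exch M B :|: exch M B').

Lemma drop_edges_avoids D : avoids e (drop_edges D).
Proof. by apply/forall_inP => p; rewrite inE => /andP[]. Qed.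

Lemma nbrs_notin B : e \notin nbrs B.
Proof. by rewrite inE eqxx. Qed.

(** An element of [B] can only be a source and one outside [B] only a target, so the exchanges
    involving [e] all leave [e] or all enter it. *)
Lemma exch_star B :
  exch M B = drop_edges (exch M B) :|: star (e \notin B) (nbrs B) e.
Proof.
apply/setP => -[a b]; rewrite in_setU.
have -> : ((a, b) \in drop_edges (exch M B)) =
  ((a, b) \in exch M B) && ((a != e) && (b != e)) by rewrite inE.
have [eB|eB] := boolP (e \in B) => /=.
  apply/idP/orP => [abB|[/andP[] //|/starP[k] + [-> ->]]].
    have [ae|ae] := eqVneq a e; last first.
      left; rewrite abB; apply: contraTneq abB => ->.
      by rewrite !inE eB andbF.
    right; apply/starP; exists b; last by rewrite ae.
    move: abB; rewrite ae !inE eB /swap eB => /and3P[_ bB ->].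
    by rewrite (negPf bB) /= andbT; apply: contraNneq bB => ->.
  by rewrite !inE eB /swap eB => /and3P[_ /eqP]; case: (k \in B).
apply/idP/orP => [abB|[/andP[] //|/starP[k] + [-> ->]]].
  have [be|be] := eqVneq b e; last first.
    left; rewrite abB andbT; apply: contraTneq abB => ->.
    by rewrite !inE (negPf eB).
  right; apply/starP; exists a; last by rewrite be.
  move: abB; rewrite be !inE /swap (negPf eB) => /and3P[aB _ ->].
  by rewrite aB /= andbT; apply: contraNneq eB => <-.
rewrite !inE /swap (negPf eB) => /and3P[_ /eqP]; by case: (k \in B).
Qed.

(** An exchange of [B] involving [e] yields one of [swap B x] involving [x], which gives the star.
    Conversely, an exchange of [swap B x] that fails for [B] factors through [x] by
    [parallel_exchange]: one half is an exchange of [B], the other belongs to the star. *)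
Lemma gcone_nbr B x : is_basis M B -> x \in nbrs B ->
  gcone R (drop_edges (exch M B) :|: star (e \notin B) (nbrs B) x) =
  gcone R (slice_edges B (swap B x)).
Proof.
move=> bB xN; have := xN; rewrite inE => /and3P[xe xBe bB'].
apply: gcone_eq_rootp => p.
  case/setUP=> [|/starP[k kN ->]].
    by rewrite !inE => /andP[pB pe]; apply: rootp_mem; rewrite !inE pB pe.
  have [->|kx] := eqVneq k x; first exact: rootp_xx.
  apply: rootp_mem; move: kN xBe; rewrite !inE /swap.
  have [eB|eB] := boolP (e \in B) => /and3P[ke].
    have [//|kB _ bk] := boolP (k \in B); have [//|xB _] := boolP (x \in B).
    rewrite /= !inE ke xe eqxx /= (negPf kx) (negPf kB) /= andbT.
    rewrite (_ : (x |: B :\ e) :\ x = B :\ e) //.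
    by set_dec (neqP ke, neqP kx, neqP xe, negPf kB, negPf xB, eB) k e x x.
  have [kB _ bk|//] := boolP (k \in B); have [xB _|//] := boolP (x \in B).
  rewrite /= !inE ke xe eqxx /= kx kB (negPf xe) /= orbT /= andbT.
  rewrite (_ : x |: _ = e |: B :\ k) //.
  by set_dec (neqP ke, neqP kx, neqP xe, negPf eB, xB, kB) k e x x.
rewrite /slice_edges {1}/drop_edges in_set => /andP[/setUP[pB|pB] pe].
  by apply: rootp_mem; apply/setUP; left; rewrite inE pB.
case: p pe pB => a b /= /andP[ae be]; rewrite [_ \in exch _ _]in_set /=.
case/and3P=> aB' bnB' bab.
have [eB|eB] := boolP (e \in B).
  have xB : x \notin B by move: xBe; rewrite eB; case: (x \in B).
  rewrite /swap eB in bB'.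
  move: aB' bnB' bab; rewrite /swap eB !inE negb_or (negPf be) /=.
  move=> aB' /andP[bx bnB] bab.
  have [ax|ax] := eqVneq a x.
    rewrite ax; apply: rootp_mem; apply/setUP; right; apply/starP; exists b => //.
    rewrite inE be eB (negPf bnB) /= /swap eB; move: bab.
    rewrite ax (_ : (x |: B :\ e) :\ x = B :\ e) //.
    by set_dec (neqP xe, neqP xe, negPf xB) x e x e.
  move: aB'; rewrite (negPf ax) ae /= => aB.
  have [bab'|bab'] := boolP (is_basis M (b |: B :\ a)).
    by apply: rootp_mem; apply/setUP; left; rewrite !inE /= aB bnB bab' ae be.
  have ab : a != b by apply: contraNneq bnB => <-.
  have F := (neqP ab, neqP ax, neqP ae, neqP bx, neqP be, neqP xe,
     aB, negPf bnB, negPf xB, eB).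
  (* Over [B :\ e :\ a] the elements [b] and [e] are parallel, whence the bases [b |: B :\ e] and
     [x |: B :\ a]. *)
  have [] := @parallel_exchange _ M (B :\ e :\ a) a b x e.
  - by rewrite !inE ?(F, eqxx, andbF).
  - by rewrite !F.
  - by rewrite (_ : _ |: _ = x |: B :\ e) //; set_dec F a b x e.
  - by rewrite (_ : _ |: _ = B) //; set_dec F a b x e.
  - by rewrite (_ : _ |: _ = b |: (x |: B :\ e) :\ a) //; set_dec F a b x e.
  - by rewrite (_ : _ |: _ = b |: B :\ a) //; set_dec F a b x e.
  rewrite (_ : a |: _ = b |: B :\ e); last by set_dec F a b x e.
  rewrite (_ : x |: _ = x |: B :\ a); last by set_dec F a b x e.
  move=> h1 h2; apply: (@rootp_trans _ _ true _ a x b); apply: rootp_mem.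
    by rewrite !inE /= aB xB h2 ae xe.
  apply/setUP; right; apply/starP; exists b => //.
  by rewrite inE be eB (negPf bnB) /swap eB.
have xB : x \in B by move: xBe; rewrite (negPf eB); case: (x \in B).
rewrite /swap (negPf eB) in bB'.
move: aB' bnB' bab; rewrite /swap (negPf eB) !inE negb_or (negPf ae) /=.
move=> /andP[ax aB] /andP[_ bnB] bab; rewrite negb_and negbK in bnB.
have [bx|bx] := eqVneq b x.
  rewrite bx; apply: rootp_mem; apply/setUP; right; apply/starP; exists a => //.
  rewrite inE ae aB (negPf eB) /= /swap (negPf eB); move: bab; rewrite bx.
  rewrite (_ : x |: _ = e |: B :\ a) //.
  by set_dec (neqP xe, neqP ax, neqP ae, negPf eB, aB, xB) x e a x.
rewrite (negPf bx) /= in bnB.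
have [bab'|bab'] := boolP (is_basis M (b |: B :\ a)).
  by apply: rootp_mem; apply/setUP; left; rewrite !inE /= aB bnB bab' ae be.
have ab : a != b by apply: contraNneq bnB => <-.
have F := (neqP ab, neqP ax, neqP ae, neqP bx, neqP be, neqP xe,
   aB, negPf bnB, xB, negPf eB).
have [] := @parallel_exchange _ M (B :\ x :\ a) a b e x.
- by rewrite !inE ?(F, eqxx, andbF).
- by rewrite !F.
- by rewrite (_ : _ |: _ = e |: B :\ x) //; set_dec F a b x e.
- by rewrite (_ : _ |: _ = B) //; set_dec F a b x e.
- by rewrite (_ : _ |: _ = b |: (e |: B :\ x) :\ a) //; set_dec F a b x e.
- by rewrite (_ : _ |: _ = b |: B :\ a) //; set_dec F a b x e.
rewrite (_ : a |: _ = b |: B :\ x); last by set_dec F a b x e.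
rewrite (_ : e |: _ = e |: B :\ a); last by set_dec F a b x e.
move=> h1 h2; apply: (@rootp_trans _ _ true _ a x b); apply: rootp_mem.
  apply/setUP; right; apply/starP; exists a => //.
  by rewrite inE ae (negPf eB) aB /swap (negPf eB).
by rewrite !inE /= bnB xB h1 be xe.
Qed.

(** The star at [e] contributes the factors [edge_coef], and the remaining cones are slices by
    [gcone_nbr]. Dropping the star leaves the same slices without these factors, as in
    [Hilb_drop_edges]. *)
Lemma Hilb_exch B : is_basis M B -> nbrs B != set0 ->
  Hilb (gcone R (exch M B)) = \sum_(x in nbrs B)
    Hilb (gcone R (slice_edges B (swap B x))) * edge_coef (e \notin B) x e.
Proof.
move=> bB N0; rewrite [in LHS]exch_star Hilb_star_edge ?nbrs_notin //.
  by apply: eq_bigr => x xN; rewrite gcone_nbr.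
exact: drop_edges_avoids.
Qed.

Lemma Hilb_drop_edges B : is_basis M B -> nbrs B != set0 ->
  Hilb (gcone R (drop_edges (exch M B))) =
  \sum_(x in nbrs B) Hilb (gcone R (slice_edges B (swap B x))).
Proof.
move=> bB N0; rewrite (@Hilb_star R n (e \notin B) (nbrs B)) //.
by apply: eq_bigr => x xN; rewrite gcone_nbr.
Qed.

End AdjacentBases.

(** * Cones of flag matroids *)

Section LiftCones.
Variables (R : realFieldType) (n : nat).
Implicit Types (D : {set 'I_n * 'I_n}) (p q : {mpoly int[n]}).
Local Notation lf := (lift (@ord0 n)).

Definition lift_edges D := [set (lf p.1, lf p.2) | p in D].

Definition tail_row (T : Type) (x : 'rV[T]_n.+1) : 'rV[T]_n := \row_i x 0 (lf i).

Definition lift_row (x : 'rV[R]_n) : 'rV[R]_n.+1 :=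
  \row_i (if unlift ord0 i is Some j then x 0 j else 0).

Lemma lift_row_root i j : lift_row (rootv R i j) = rootv R (lf i) (lf j).
Proof.
apply/rowP => k; rewrite !mxE /=.
case: unliftP => [k' ->|->]; first by rewrite !mxE /= !(inj_eq lift_inj).
by rewrite !(negPf (neq_lift _ _)) subrr.
Qed.

Lemma gcone_lift D (y : 'rV[R]_n.+1) :
  gcone R (lift_edges D) y <-> y 0 ord0 = 0 /\ gcone R D (tail_row y).
Proof.
split.
  elim/gcone_ind.
  - split; first by rewrite mxE.
    by rewrite (_ : tail_row 0 = 0); [apply: cone_hull0 | apply/rowP => i; rewrite !mxE].
  - move=> {}y y' [y0 Dy] [y'0 Dy']; split; first by rewrite mxE y0 y'0 addr0.
    rewrite (_ : tail_row _ = tail_row y + tail_row y'); first exact: cone_hullD.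
    by apply/rowP => i; rewrite !mxE.
  - move=> a {}y a0 [y0 Dy]; split; first by rewrite mxE y0 mulr0.
    rewrite (_ : tail_row _ = a *: tail_row y); first exact: cone_hullZ.
    by apply/rowP => i; rewrite !mxE.
  - move=> i j /imsetP[[i' j'] Dij [-> ->]]; rewrite -lift_row_root; split.
      by rewrite mxE unlift_none.
    rewrite (_ : tail_row _ = rootv R i' j'); first exact: gcone_root.
    by apply/rowP => k; rewrite !mxE liftK !mxE.
case=> y0 Dy; have -> : y = lift_row (tail_row y).
  by apply/rowP => k; rewrite !mxE; case: unliftP => [k' ->|->]; rewrite ?mxE.
move: (tail_row y) Dy => x; elim/gcone_ind.
- rewrite (_ : lift_row 0 = 0); first exact: cone_hull0.
  by apply/rowP => k; rewrite !mxE; case: unliftP => // j _; rewrite mxE.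
- move=> {}x x' Dx Dx'; rewrite (_ : lift_row _ = lift_row x + lift_row x').
    exact: cone_hullD.
  apply/rowP => k; rewrite !mxE; case: unliftP => [j _|_]; first by rewrite mxE.
  by rewrite addr0.
- move=> a {}x a0 Dx; rewrite (_ : lift_row _ = a *: lift_row x).
    exact: cone_hullZ.
  apply/rowP => k; rewrite !mxE; case: unliftP => [j _|_]; first by rewrite mxE.
  by rewrite mulr0.
- move=> i j Dij; rewrite lift_row_root; apply: gcone_root.
  by apply/imsetP; exists (i, j).
Qed.

Lemma up_polyX (m : 'X_{1..n}) : exists m' : 'X_{1..n.+1},
  [/\ up_poly 'X_[m] = 'X_[m'], m' ord0 = 0%N & forall i, m' (lf i) = m i].
Proof.
exists [multinom (if unlift ord0 i is Some j then m j else 0%N) | i < n.+1].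
split; last 2 first.
- by rewrite mnmE unlift_none.
- by move=> i; rewrite mnmE liftK.
rewrite /up_poly comp_mpolyX [RHS]mpolyXE_id big_ord_recl mnmE unlift_none expr0 mul1r.
by apply: eq_bigr => i _; rewrite tnth_mktuple mnmE liftK.
Qed.

Lemma series_mul_up p (S : 'rV[int]_n -> int) (S' : 'rV[int]_n.+1 -> int) l :
    (forall l, S' l = (l 0 ord0 == 0)%:R * S (tail_row l)) ->
  series_mul (up_poly p) S' l = (l 0 ord0 == 0)%:R * series_mul p S (tail_row l).
Proof.
move=> SS'; elim/mpolyind: p => [|c m p _ _ IHp].
  by rewrite rmorph0 !series_mul0 mulr0.
rewrite rmorphD /= !series_mulD IHp mulrDr; congr (_ + _).
rewrite /up_poly comp_mpolyZ -/(up_poly _).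
have [m' [-> m'0 m'E]] := up_polyX m.
rewrite !series_mulZX SS' mulrCA; congr (_ * (_ * _)).
  by rewrite !mxE m'0 subr0.
by congr S; apply/rowP => i; rewrite !mxE m'E.
Qed.

(** A lifted cone lies in the hyperplane where the coordinate of [ord0] vanishes. Its series is an
    extension by zero, so a relation [q * S = p] lifts through [up_poly]. *)
Lemma Hilb_lift D : Hilb (gcone R (lift_edges D)) = up_frac (Hilb (gcone R D)).
Proof.
have DT d : d \in D -> d.1 \in [set: 'I_n] /\ d.2 \in [set: 'I_n] by rewrite !inE.
have [p [q [/diff_prod_neq0 q0 -> pq]]] := asum_gcone R DT.
rewrite up_fracE //; apply: HilbE; exists (up_poly p), (up_poly q).
split=> //; first by rewrite up_poly_eq0.
move=> l; rewrite (@series_mul_up _ (hgcone R D)).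
  rewrite (@series_mul_up _ (@series_one n)) ?pq // => {}l.
  rewrite /series_one -natrM mulnb; congr (nat_of_bool _)%:R.
  apply/eqP/andP => [->|[/eqP l0 /eqP l1]].
    by rewrite !mxE eqxx; split=> //; apply/eqP/rowP => i; rewrite !mxE.
  apply/rowP => i; rewrite mxE; case: (unliftP ord0 i) => [j ->|-> //].
  by move/rowP/(_ j): l1; rewrite !mxE.
move=> {}l; rewrite /hgcone /hilb_series -natrM mulnb; congr (nat_of_bool _)%:R.
have e : map_mx (fun z : int => z%:~R) (tail_row l) =
    tail_row (map_mx (fun z : int => z%:~R) l) :> 'rV[R]_n.
  by apply/rowP => i; rewrite !mxE.
apply/asboolP/andP; rewrite gcone_lift e mxE => -[h1 h2]; split.
- by rewrite -(@intr_eq0 R) h1.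
- exact/asboolP.
- by apply/eqP; rewrite intr_eq0.
- exact/asboolP.
Qed.

End LiftCones.

(** * Two-step flags and the cones of [(M, M)] *)

Section FlagCones.
Variables (R : realFieldType) (n : nat).

Lemma flag_cone_gen k (M : flag_matroid n k) B B' : is_flag_basis M B' ->
  flag_cone M B (flag_vec R B' - flag_vec R B).
Proof.
move=> bB'; apply: cone_hull_gen; exists (flag_vec R B') => //.
exists 1%N, (fun=> 1), (fun=> flag_vec R B'); split=> //.
- by rewrite big_ord1.
- by move=> _; exists B'.
- by rewrite big_ord1 scale1r.
Qed.

Lemma flag_cone_sub k (M : flag_matroid n k) B D :
    (forall B', is_flag_basis M B' -> gcone R D (flag_vec R B' - flag_vec R B)) ->
  forall x, flag_cone M B x -> gcone R D x.
Proof.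
move=> BD; apply: cone_hull_sub => _ [_ [m [c [s [c0 c1 Ms ->]]]] <-].
rewrite -[flag_vec R B]scale1r -c1 scaler_suml -sumrB; apply: cone_hull_sum => i _.
by rewrite -scalerBr; apply: cone_hullZ => //; have [B' /BD ? <-] := Ms i.
Qed.

Definition pair_flag (X Y : {set 'I_n}) : {ffun 'I_2 -> {set 'I_n}} :=
  [ffun i => if i == ord0 then X else Y].

Lemma pair_flag0 X Y : pair_flag X Y ord0 = X. Proof. by rewrite ffunE. Qed.
Lemma pair_flag1 X Y : pair_flag X Y ord_max = Y. Proof. by rewrite ffunE. Qed.

Lemma pair_flagK (F : {ffun 'I_2 -> {set 'I_n}}) : pair_flag (F ord0) (F ord_max) = F.
Proof.
apply/ffunP => i; rewrite ffunE; case: eqP => [-> //|ni]; congr (F _).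
apply: val_inj; case: i ni => [[|[|i]] Hi] //= ni.
by case: ni; apply: val_inj.
Qed.

Lemma pair_flag_vec X Y : flag_vec R (pair_flag X Y) = indic_vec R X + indic_vec R Y.
Proof.
rewrite /flag_vec big_ord_recl big_ord1 pair_flag0.
by rewrite (_ : lift ord0 ord0 = ord_max) ?pair_flag1 //; apply: val_inj.
Qed.

Lemma pair_flag_basis (M N : matroid n) (q : matroid_quotient M N) X Y :
  is_flag_basis (flag2 q) (pair_flag X Y) =
  [&& is_basis M X, is_basis N Y & X \subset Y].
Proof.
apply/andP/and3P => [[/forallP b /forallP s]|[bX bY XY]].
  have := b ord0; have := b ord_max; have /forallP/(_ ord_max)/implyP := s ord0.
  by rewrite pair_flag0 pair_flag1 /= => ? ? ?; split; auto.
split; apply/forallP => i.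
  by rewrite /= /flag2_fun ffunE; case: eqP.
apply/forallP => j; apply/implyP; rewrite !ffunE.
by case: i j => [[|[|i]] Hi] [[|[|j]] Hj].
Qed.

(** The flags are the pairs [(B, B)], so the polytope is twice the matroid polytope, and each root
    is half a difference of vertices. *)
Lemma flag_cone_refl (M : matroid n) B : is_basis M B ->
  flag_cone (flag2 (quotient_refl M)) (pair_flag B B) = gcone R (exch M B).
Proof.
move=> bB; apply/seteqP; split=> x.
  apply: flag_cone_sub => F; rewrite -(pair_flagK F) pair_flag_basis.
  case/and3P=> bX bY _; rewrite !pair_flag_vec opprD addrACA.
  by apply: cone_hullD; apply: basis_gcone.
apply: gcone_ind.
- exact: cone_hull0.
- exact: cone_hullD.
- by move=> a y; apply: cone_hullZ.
- move=> a b; rewrite inE => /and3P[/= aB bnB bB'].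
  have : is_flag_basis (flag2 (quotient_refl M))
      (pair_flag (b |: B :\ a) (b |: B :\ a)).
    by rewrite pair_flag_basis bB' subxx.
  move=> /(flag_cone_gen (pair_flag B B)); rewrite !pair_flag_vec opprD addrACA.
  rewrite indic_exchange // [_ + rootv R a b]addrC addrK -mulr2n => h.
  rewrite -[rootv R a b](@scalerK _ _ 2%:R) ?pnatr_eq0 // scaler_nat.
  by apply: cone_hullZ => //; rewrite invr_ge0 ler0n.
Qed.

End FlagCones.

(** * Deletion and contraction *)

Section Minors.
Variables (R : realFieldType) (n : nat) (M : matroid n.+1).
Hypotheses (loopM : ~~ is_loop M ord0) (coloopM : ~~ is_coloop M ord0).
Implicit Types (X Y : {set 'I_n}) (B : {set 'I_n.+1}).
Local Notation lf := (lift (@ord0 n)).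
Local Notation C := (contract M ord0).
Local Notation D := (delete M ord0).

Definition up_set X : {set 'I_n.+1} := lf @: X.

Lemma mem_up_set i X : (lf i \in up_set X) = (i \in X).
Proof. exact/mem_imset/lift_inj. Qed.

Lemma up_set0 X : ord0 \notin up_set X.
Proof. by apply/imsetP => -[x _ /eqP]; rewrite (negPf (neq_lift _ _)). Qed.

Lemma up_setK X : lf @^-1: up_set X = X.
Proof. by apply/setP => i; rewrite inE mem_up_set. Qed.

Lemma preim_up_set B : up_set (lf @^-1: B) = B :\ ord0.
Proof.
apply/setP => i; case: (unliftP ord0 i) => [j ->|->].
  by rewrite mem_up_set !inE eq_sym neq_lift.
by rewrite (negPf (up_set0 _)) !inE eqxx.
Qed.

Lemma card_up_set X : #|up_set X| = #|X|.
Proof. by rewrite card_imset //; apply: lift_inj. Qed.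

Lemma up_set_exchange X a b : up_set (b |: X :\ a) = lf b |: up_set X :\ lf a.
Proof.
apply/setP => i; case: (unliftP ord0 i) => [j ->|->].
  by rewrite mem_up_set !inE mem_up_set !(inj_eq lift_inj).
by rewrite !inE !(negPf (up_set0 _)) andbF orbF (negPf (neq_lift _ _)).
Qed.

Lemma up_setU1_exchange X a b :
  ord0 |: up_set (b |: X :\ a) = lf b |: (ord0 |: up_set X) :\ lf a.
Proof.
rewrite up_set_exchange; apply/setP => i; rewrite !inE.
by case: (eqVneq i ord0) => [->|]; rewrite ?orbT // (neq_lift _ _).
Qed.

Lemma delete_mrank : mrank D = mrank M.
Proof.
case/forallPn: coloopM => B; rewrite negb_imply => /andP[/basisP[cB rB] B0].
apply/eqP; rewrite eqn_leq; apply/andP; split; first exact: rk_le_mrank.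
rewrite -rB; apply: rk_mono; apply/subsetP => i iB.
case: (unliftP ord0 i) iB => [j -> _|->]; first by rewrite imset_f.
by rewrite (negPf B0).
Qed.

Lemma delete_basis X : is_basis D X = is_basis M (up_set X).
Proof. by rewrite /is_basis delete_mrank card_up_set. Qed.

Lemma rk_ord0 : M [set ord0] = 1%N.
Proof.
have := rk_le_card M [set ord0]; move: loopM; rewrite cards1 /is_loop.
by case: (M _) => [|[]].
Qed.

Lemma rk_ge_ord0 A : (0 < M (ord0 |: A))%N.
Proof. by rewrite -rk_ord0; apply: rk_mono; apply: subsetUl. Qed.

Lemma contract_mrank : mrank M = (mrank C).+1.
Proof.
rewrite /mrank /= /contract_rk rk_ord0 subn1 prednK ?rk_ge_ord0 //; congr (M _).
apply/setP => i; case: (unliftP ord0 i) => [j ->|->]; rewrite !inE ?eqxx //.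
by rewrite imset_f ?orbT.
Qed.

Lemma contract_basis X : is_basis C X = is_basis M (ord0 |: up_set X).
Proof.
rewrite /is_basis contract_mrank cardsU1 up_set0 card_up_set.
rewrite {1 2}/rk /= /contract_rk rk_ord0 -/(up_set X) subn1.
by have := rk_ge_ord0 (up_set X); case: (M _) => // m _; rewrite !eqSS.
Qed.

Lemma lift_exch_delete X :
  lift_edges (exch D X) = drop_edges ord0 (exch M (up_set X)).
Proof.
apply/setP => -[a b]; rewrite in_set /=.
apply/imsetP/andP => [[[a' b']]|].
  rewrite in_set delete_basis up_set_exchange /= => h [-> ->].
  by rewrite in_set /= !mem_up_set ?(eq_sym _ ord0) ?neq_lift.
case=> + /andP[a0 b0]; rewrite in_set /=.
move: a0 b0; case: (unliftP ord0 a) => [a' ->|->]; last by rewrite eqxx.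
case: (unliftP ord0 b) => [b' -> _ _|->]; last by rewrite eqxx.
move=> h; exists (a', b') => //.
by move: h; rewrite in_set /= !mem_up_set delete_basis up_set_exchange.
Qed.

Lemma lift_exch_contract X :
  lift_edges (exch C X) = drop_edges ord0 (exch M (ord0 |: up_set X)).
Proof.
have up0 i : (lf i \in ord0 |: up_set X) = (i \in X).
  by rewrite !inE mem_up_set eq_sym (negPf (neq_lift _ _)).
apply/setP => -[a b]; rewrite in_set /=.
apply/imsetP/andP => [[[a' b']]|].
  rewrite in_set contract_basis up_setU1_exchange /= => h [-> ->].
  by rewrite in_set /= !up0 ?(eq_sym _ ord0) ?neq_lift.
case=> + /andP[a0 b0]; rewrite in_set /=.
move: a0 b0; case: (unliftP ord0 a) => [a' ->|->]; last by rewrite eqxx.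
case: (unliftP ord0 b) => [b' -> _ _|->]; last by rewrite eqxx.
move=> h; exists (a', b') => //.
by move: h; rewrite !up0 in_set contract_basis up_setU1_exchange.
Qed.

Lemma Hilb_delete X :
  up_frac (Hilb (gcone R (exch D X))) =
  Hilb (gcone R (drop_edges ord0 (exch M (up_set X)))).
Proof. by rewrite -Hilb_lift lift_exch_delete. Qed.

Lemma Hilb_contract X :
  up_frac (Hilb (gcone R (exch C X))) =
  Hilb (gcone R (drop_edges ord0 (exch M (ord0 |: up_set X)))).
Proof. by rewrite -Hilb_lift lift_exch_contract. Qed.

Local Notation CD := (flag2 (contract_delete_quotient M ord0)).

(** Differences of flags are handled by [basis_gcone]. Conversely, with [Y = i |: X], an exchange of
    [a] for [b] not involving [i] either applies to both members of the flag, or its root is the sum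
    of those from [a] to [i] and from [i] to [b], each of which moves one member only. *)
Lemma flag_cone_contract_delete X Y : is_basis C X -> is_basis D Y -> X \subset Y ->
  flag_cone CD (pair_flag X Y) = gcone R (exch C X :|: exch D Y).
Proof.
move=> bX bY XY; set F := flag_cone _ _.
have cXY : #|Y| = #|X|.+1.
  by case/basisP: bX => -> _; case/basisP: bY => -> _; rewrite -contract_mrank delete_mrank.
have [i YE iX] : exists2 i, Y = i |: X & i \notin X.
  have /properP[_ [i iY iX]] : X \proper Y by rewrite properEcard XY cXY ltnSn.
  exists i => //; apply/eqP; rewrite eq_sym eqEcard subUset sub1set iY XY.
  by rewrite cXY cardsU1 iX leqnn.
have iY : i \in Y by rewrite YE setU11.
have flagP X' Y' : is_basis C X' -> is_basis D Y' -> X' \subset Y' ->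
    F (indic_vec R X' - indic_vec R X + (indic_vec R Y' - indic_vec R Y)).
  move=> bX' bY' XY'; rewrite addrACA -opprD -!pair_flag_vec.
  by apply: flag_cone_gen; rewrite pair_flag_basis bX' bY'.
(* Both members of the flag move, which yields twice the root. *)
have F2 a b : a \in X -> b \notin Y -> is_basis C (b |: X :\ a) ->
    is_basis D (b |: Y :\ a) -> F (rootv R a b).
  move=> aX bY' bCX bDY; have aY := subsetP XY _ aX.
  have bX' : b \notin X by apply: contraNN bY' => /(subsetP XY).
  have := flagP _ _ bCX bDY (setUS _ (setSD _ XY)).
  rewrite !indic_exchange // ![_ + rootv R a b]addrC !addrK -mulr2n => h.
  rewrite -[rootv R a b](@scalerK _ _ 2%:R) ?pnatr_eq0 // scaler_nat.
  by apply: cone_hullZ => //; rewrite invr_ge0 ler0n.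
(* A root into [i] moves [X] alone, and in [F1] a root out of [i] moves [Y] alone; the inclusion
   persists. *)
have F0 a : a \in X -> is_basis C (i |: X :\ a) -> F (rootv R a i).
  move=> aX bC; have := flagP _ _ bC bY; rewrite subrr addr0 indic_exchange //.
  rewrite addrC addKr; apply.
  by rewrite YE setUS // subsetDl.
have XYi : X = Y :\ i by rewrite YE setU1K.
have F1 b : b \notin Y -> is_basis D (b |: Y :\ i) -> F (rootv R i b).
  move=> bY' bD; have := flagP _ _ bX bD; rewrite subrr add0r indic_exchange //.
  rewrite addrC addKr; apply.
  by rewrite {1}XYi subsetUr.
have F01 a b : F (rootv R a i) -> F (rootv R i b) -> F (rootv R a b).
  by rewrite -(rootv_trans R a i b); apply: cone_hullD.
(* When exactly one of the two exchanges is possible, [parallel_exchange] applies in [M] over the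
   lift of [X :\ a], with [ord0] and the lift of [i] as the last two elements, in the order given by
   the exchange that is possible. *)
have par a b : a \in X -> b \notin Y ->
    is_basis C (b |: X :\ a) != is_basis D (b |: Y :\ a) ->
  is_basis D (b |: Y :\ i) /\ is_basis C (i |: X :\ a).
  move=> aX bY' bCD.
  have bX' : b \notin X by apply: contraNN bY' => /(subsetP XY).
  have ab : a != b by apply: contraNneq bX' => <-.
  have ai : a != i by apply: contraNneq iX => <-.
  have bi : b != i by apply: contraNneq bY' => ->.
  have l0 j : lf j != ord0 by rewrite eq_sym neq_lift.
  have lfN j k : j != k -> lf j != lf k by rewrite (inj_eq lift_inj).
  pose A := up_set (X :\ a).
  have facts := (neqP (l0 a), neqP (l0 b), neqP (l0 i), neqP (lfN _ _ ab),
     neqP (lfN _ _ ai), neqP (lfN _ _ bi), mem_up_set, negPf (up_set0 X),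
     negPf (up_set0 (X :\ a)), aX, negPf bX', negPf iX, neqP ai, neqP ab, neqP bi).
  have e1 : lf a |: (ord0 |: A) = ord0 |: up_set X.
    apply/setP => z; rewrite !inE; case: (unliftP ord0 z) => [z' ->|->].
      rewrite !mem_up_set !inE !(inj_eq lift_inj).
      by case: (eqVneq z' a) => [->|_]; rewrite ?aX ?orbT.
    by rewrite eqxx orbT.
  have e2 : lf a |: (lf i |: A) = up_set Y.
    apply/setP => z; rewrite !inE; case: (unliftP ord0 z) => [z' ->|->].
      rewrite !mem_up_set YE !inE !(inj_eq lift_inj).
      by case: (eqVneq z' a) => [->|_]; rewrite ?aX ?orbT.
    by rewrite !facts !(negPf (up_set0 _)).
  have e3 : lf b |: (ord0 |: A) = ord0 |: up_set (b |: X :\ a).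
    apply/setP => z; rewrite !inE; case: (unliftP ord0 z) => [z' ->|->].
      by rewrite !mem_up_set !inE !(inj_eq lift_inj) [_ == ord0]eq_sym (negPf (neq_lift _ _)).
    by rewrite eqxx orbT.
  have e4 : lf b |: (lf i |: A) = up_set (b |: Y :\ a).
    apply/setP => z; rewrite !inE; case: (unliftP ord0 z) => [z' ->|->].
      rewrite !mem_up_set YE !inE !(inj_eq lift_inj).
      by case: (eqVneq z' a) => [->|_]; rewrite ?(facts, orbT).
    by rewrite !facts !(negPf (up_set0 _)).
  have e5 : lf a |: (lf b |: A) = up_set (b |: Y :\ i).
    apply/setP => z; rewrite -XYi !inE; case: (unliftP ord0 z) => [z' ->|->].
      rewrite !mem_up_set !inE !(inj_eq lift_inj).
      by case: (eqVneq z' a) => [->|_]; rewrite ?(facts, orbT).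
    by rewrite !facts !(negPf (up_set0 _)).
  have e6 : ord0 |: (lf i |: A) = ord0 |: up_set (i |: X :\ a).
    apply/setP => z; rewrite !inE; case: (unliftP ord0 z) => [z' ->|->].
      by rewrite !mem_up_set !inE !(inj_eq lift_inj).
    by rewrite eqxx.
  have B1 : is_basis M (lf a |: (ord0 |: A)) by rewrite e1 -contract_basis.
  have B2 : is_basis M (lf a |: (lf i |: A)) by rewrite e2 -delete_basis.
  move: bCD; rewrite !contract_basis !delete_basis -e3 -e4 -e5 -e6.
  have [B3 B4|B3 B4] := boolP (is_basis M (lf b |: (ord0 |: A))).
    by apply: parallel_exchange B3 B4 => //; rewrite /A ?(facts, inE, eqxx, andbF).
  have {}B4 : is_basis M (lf b |: (lf i |: A)) by move: B4; case: (is_basis M _).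
  rewrite [ord0 |: _]setUCA.
  by apply: parallel_exchange B4 B3 => //; rewrite /A ?(facts, inE, eqxx, andbF).
apply/seteqP; split=> x.
  apply: flag_cone_sub => G; rewrite -(pair_flagK G) pair_flag_basis.
  case/and3P=> bX' bY' _; rewrite !pair_flag_vec opprD addrACA.
  apply: cone_hullD.
    by apply: gconeS (basis_gcone R bX bX'); apply: subsetUl.
  by apply: gconeS (basis_gcone R bY bY'); apply: subsetUr.
apply: gcone_ind.
- exact: cone_hull0.
- exact: cone_hullD.
- by move=> a y; apply: cone_hullZ.
- move=> a b /setUP[]; rewrite inE => /and3P[/= aX bX' bB].
    have [bi|bi] := eqVneq b i; first by rewrite bi in bB *; apply: F0.
    have bY' : b \notin Y by rewrite YE !inE negb_or bi.
    have [bD|bD] := boolP (is_basis D (b |: Y :\ a)); first exact: F2.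
    have [] := par a b aX bY'; first by rewrite bB (negPf bD).
    by move=> /(F1 _ bY') h /(F0 _ aX) h'; apply: F01 h' h.
  have [ai|ai] := eqVneq a i; first by rewrite ai in bB *; apply: F1.
  have {}aX : a \in X by rewrite XYi !inE ai.
  have [bC|bC] := boolP (is_basis C (b |: X :\ a)); first exact: F2.
  have [] := par a b aX; rewrite ?bB ?(negPf bC) //.
  by move=> /F1 h /(F0 _ aX) h'; apply: F01 h' (h _).
Qed.

Lemma lift_slice_edges X Y :
  lift_edges (exch C X :|: exch D Y) =
  slice_edges M ord0 (ord0 |: up_set X) (up_set Y).
Proof.
rewrite /lift_edges imsetU -!/(lift_edges _) lift_exch_contract lift_exch_delete.
by apply/setP => p; rewrite /slice_edges /drop_edges in_setU !in_set -andb_orl.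
Qed.

Lemma Hilb_contract_delete X Y : is_basis C X -> is_basis D Y -> X \subset Y ->
  up_frac (Hilb (flag_cone (R := R) CD (pair_flag X Y))) =
  Hilb (gcone R (slice_edges M ord0 (ord0 |: up_set X) (up_set Y))).
Proof.
by move=> bX bY XY; rewrite flag_cone_contract_delete // -Hilb_lift lift_slice_edges.
Qed.

End Minors.

(** * Sums over pairs of adjacent bases *)

Section BasisPairs.
Variables (R : realFieldType) (n : nat) (M : matroid n) (e : 'I_n).
Implicit Types (B : {set 'I_n}) (x : 'I_n).
Local Notation swap := (swap e).
Local Notation nbrs := (nbrs M e).
Local Notation Hslice B x := (Hilb (gcone R (slice_edges M e B (swap B x)))).

Lemma swapP B x : x \in nbrs B ->
  [/\ swap (swap B x) x = B, (e \in swap B x) = (e \notin B),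
      is_basis M (swap B x) & is_basis M B -> x \in nbrs (swap B x)].
Proof.
rewrite inE => /and3P[xe xB bB].
have eS : (e \in swap B x) = (e \notin B).
  by rewrite /swap; case: ifP => [eB|/negbT eB]; rewrite !inE eqxx // eq_sym (negPf xe).
have xS : (x \in swap B x) = (x \notin B).
  move: xB; rewrite /swap; case: ifP => [eB|/negbT eB]; rewrite !inE ?eqxx //.
    by case: (x \in B).
  by rewrite (negPf xe) /=; case: (x \in B).
have SS : swap (swap B x) x = B.
  rewrite {1}/swap eS; move: xB; rewrite /swap.
  have [eB|eB] /= := boolP (e \in B); case: (boolP (x \in B)) => // xB _.
    by set_dec (neqP xe, eB, negPf xB) x e x e.
  by set_dec (neqP xe, negPf eB, xB) x e x e.
split=> // bB'; rewrite inE xe xS eS SS bB' andbT /=.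
by move: xB; case: (x \in B); case: (e \in B).
Qed.

Lemma slice_edgesC B B' : slice_edges M e B B' = slice_edges M e B' B.
Proof. by rewrite /slice_edges setUC. Qed.

Variable V : lmodType (ratfun n).
Implicit Type phi : {set 'I_n} -> V.

(** Each edge of the basis graph that exchanges [e] is counted from its other end. *)
Lemma sum_swap (G : {set 'I_n} -> 'I_n -> V) :
  \sum_(B | is_basis M B && (e \in B)) \sum_(x in nbrs B) G B x =
  \sum_(B | is_basis M B && (e \notin B)) \sum_(x in nbrs B) G (swap B x) x.
Proof.
rewrite !pair_big_dep /=.
rewrite (reindex_onto (fun p => (swap p.1 p.2, p.2)) (fun p => (swap p.1 p.2, p.2))) /=.
  apply: eq_bigl => -[B x] /=; rewrite xpair_eqE eqxx andbT.
  apply/andP/andP.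
    case=> /andP[/andP[bS eS] xS] /eqP SS; have [_ h1 h2 h3] := swapP xS.
    rewrite SS eS /= in h1 h2 h3.
    by rewrite h1 h2; split=> //; apply: h3.
  case=> /andP[bB eB] xB; have [h1 h2 h3 h4] := swapP xB.
  by rewrite h1 h2 h3 eB eqxx h4.
by case=> B x /= /andP[_ /swapP[-> _ _ _]].
Qed.

(** The two ends of an edge share their slice, so their contributions combine. Bases without
    neighbours, which occur only if [e] is a loop or a coloop, are kept because integrality uses
    every [e]. The module [V] covers both polynomial weights and scalars. *)
Lemma sum_basis_pairs phi :
  \sum_(B | is_basis M B) Hilb (gcone R (exch M B)) *: phi B =
  \sum_(B | is_basis M B && (nbrs B == set0)) Hilb (gcone R (exch M B)) *: phi B +
  \sum_(B | is_basis M B && (e \notin B)) \sum_(x in nbrs B) Hslice B x *: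
    (edge_coef true x e *: phi B + edge_coef false x e *: phi (swap B x)).
Proof.
rewrite (bigID (fun B => nbrs B == set0)) /=; congr (_ + _).
transitivity (\sum_(B | is_basis M B) \sum_(x in nbrs B)
    (Hslice B x * edge_coef (e \notin B) x e) *: phi B).
  rewrite [RHS](bigID (fun B => nbrs B == set0)) /= [X in _ = X + _]big1 ?add0r.
    apply: eq_bigr => B /andP[bB N0]; by rewrite (Hilb_exch R bB N0) scaler_suml.
  by move=> B /andP[_ /eqP ->]; rewrite big_set0.
rewrite (bigID (fun B => e \in B)) /= sum_swap -big_split.
apply: eq_bigr => B /andP[bB eB]; rewrite -big_split; apply: eq_bigr => x xN /=.
have [SS eS bS NS] := swapP xN.
by rewrite SS eS eB /= addrC scalerDr !scalerA slice_edgesC.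
Qed.

(** The flag [s] selects the end of each edge that carries [phi]: true serves the contraction, false
    the deletion. *)
Lemma sum_drop_edges (s : bool) phi :
    (forall B, is_basis M B -> nbrs B != set0) ->
  \sum_(B | is_basis M B && ((e \in B) == s))
     Hilb (gcone R (drop_edges e (exch M B))) *: phi B =
  \sum_(B | is_basis M B && (e \notin B)) \sum_(x in nbrs B) Hslice B x *:
    phi (if s then swap B x else B).
Proof.
move=> N0; transitivity (\sum_(B | is_basis M B && ((e \in B) == s))
    \sum_(x in nbrs B) Hslice B x *: phi B).
  apply: eq_bigr => B /andP[bB _]; rewrite (Hilb_drop_edges R bB) ?N0 //.
  by rewrite scaler_suml.
case: s.
  under eq_bigl do rewrite eqb_id; rewrite sum_swap.
  apply: eq_bigr => B _; apply: eq_bigr => x /swapP[SS _ _ _].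
  by rewrite SS slice_edgesC.
by under eq_bigl do rewrite eqbF_neg.
Qed.

End BasisPairs.

(** * Product form of the inner sums *)

Section Weights.

(** The double sum over [p] and [q] in [KTT_shift], together with its monomial prefactor, factors
    into this product. The ring is arbitrary because integrality also needs the weights over integer
    polynomials. *)
Definition weight (A : comPzRingType) n (t : 'I_n -> A) u v (X Y : {set 'I_n}) : A :=
  (\prod_(i in X) t i) * (\prod_(i in Y) (t i + u)) * \prod_(i in ~: X) (1 + v * t i).

Lemma prodD_powerset (A : comPzRingType) (I : finType) (Y : {set I}) (f g : I -> A) :
  \prod_(i in Y) (f i + g i) =
  \sum_(p in powerset Y) (\prod_(i in p) f i) * \prod_(i in Y :\: p) g i.
Proof.
rewrite big_mkcond /=.
rewrite (eq_bigr (fun i => (if i \in Y then f i else 0) + (if i \in Y then g i else 1))).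
  rewrite bigA_distr (bigID (mem (powerset Y))) /= [X in _ + X]big1 ?addr0.
    apply: eq_bigr => J; rewrite inE => /subsetP JY.
    rewrite [X in X * _]big_mkcond [X in _ * X]big_mkcond -big_split /=.
    apply: eq_bigr => i _; rewrite inE; case: ifP => [/JY -> |_] /=; rewrite ?mulr1 ?mul1r //.
  move=> J; rewrite inE => /subsetPn[i iJ iY].
  by rewrite (bigD1 i) //= iJ (negPf iY) mul0r.
by move=> i _; case: ifP => _ //; rewrite add0r.
Qed.

Variables (R : realFieldType) (n : nat).
Local Notation Rtv := {mpoly (ratfun n)[2]}.

Definition tvar (i : 'I_n) : Rtv := (tfrac 'X_i)%:MP.

Lemma KTT_shift_flag2 (M N : matroid n) (q : matroid_quotient M N) (u v : Rtv) :
  KTT_shift R (flag2 q) u v =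
  \sum_(X | is_basis M X) \sum_(Y | is_basis N Y && (X \subset Y))
    Hilb (flag_cone (R := R) (flag2 q) (pair_flag X Y)) *: weight tvar u v X Y.
Proof.
rewrite pair_big_dep /KTT_shift.
rewrite (reindex (fun p : {set 'I_n} * {set 'I_n} => pair_flag p.1 p.2)) /=; last first.
  exists (fun F => (F ord0, F ord_max)) => [[X Y] _|F _] /=.
    by rewrite pair_flag0 pair_flag1.
  exact: pair_flagK.
apply: eq_big => [[X Y]|[X Y]] /=; first by rewrite pair_flag_basis.
rewrite pair_flag_basis => /and3P[_ bY _]; congr (_ *: _).
have -> : mrank (flag2_fun M N ord_max) = #|Y|.
  by case/basisP: bY => ->.
rewrite pair_flag0 pair_flag1 /weight.
have -> : \prod_(i in ~: X) (1 + v * tvar i) =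
    \sum_(p in powerset (~: X)) (tmon p)%:MP * v ^+ #|p|.
  under eq_bigr do rewrite addrC.
  rewrite prodD_powerset; apply: eq_bigr => p _; rewrite [X in _ * X]big1 // mulr1.
  by rewrite big_split prodr_const /= mulrC /tmon rmorph_prod.
have -> : \prod_(i in Y) (tvar i + u) =
    \sum_(p in powerset Y) (tmon p)%:MP * u ^+ (#|Y| - #|p|).
  rewrite prodD_powerset; apply: eq_bigr => p; rewrite inE => pY.
  by rewrite prodr_const cardsD (setIidPr pY) /tmon rmorph_prod.
have -> : \prod_(i < 2 | i != ord_max) tmon (pair_flag X Y i) = tmon X.
  rewrite (big_pred1 ord0) ?pair_flag0 // => i.
  by case: i => [[|[|i]] Hi].
have -> : \prod_(i in X) tvar i = (tmon X)%:MP by rewrite /tmon rmorph_prod.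
rewrite [X in _ = X * _]mulr_sumr mulr_suml; apply: eq_bigr => p _.
rewrite mulr_sumr; apply: eq_bigr => p' _.
by rewrite -mul_mpolyC !rmorphM /=; ring.
Qed.

Lemma KTT_shift_refl (M : matroid n) (u v : Rtv) :
  KTT_shift R (flag2 (quotient_refl M)) u v =
  \sum_(X | is_basis M X) Hilb (gcone R (exch M X)) *: weight tvar u v X X.
Proof.
rewrite KTT_shift_flag2; apply: eq_bigr => X bX.
rewrite (big_pred1 X) ?flag_cone_refl // => Y /=.
apply/andP/eqP => [[bY XY]|->] //; apply/eqP; rewrite eq_sym eqEcard XY.
by case/basisP: bX => -> _; case/basisP: bY => -> _; rewrite leqnn.
Qed.

End Weights.

(** * The equivariant deletion-contraction formula *)

Section DeletionContraction.
Variables (R : realFieldType) (n : nat) (M : matroid n.+1).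
Hypotheses (loopM : ~~ is_loop M ord0) (coloopM : ~~ is_coloop M ord0).
Implicit Types (X Y : {set 'I_n}) (B : {set 'I_n.+1}).
Local Notation lf := (lift (@ord0 n)).
Local Notation C := (contract M ord0).
Local Notation D := (delete M ord0).
Local Notation swap := (swap ord0).
Local Notation nbrs := (nbrs M ord0).
Local Notation Rtv := {mpoly (ratfun n.+1)[2]}.
Local Notation tv := (@tvar n.+1).

(** If [ord0] is in [B], exchange with a basis avoiding it, as [ord0] is not a coloop; otherwise its
    fundamental circuit has another element, as it is not a loop. *)
Lemma nbrs_neq0 B : is_basis M B -> nbrs B != set0.
Proof.
move=> bB; apply/set0Pn; have [B0|B0] := boolP (ord0 \in B).
  case/forallPn: coloopM => B'; rewrite negb_imply => /andP[bB' B'0].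
  have [a [aB' aB b1 b2]] := sym_exchange bB' bB B0 B'0.
  exists a; rewrite inE /swap B0 b2 (negPf aB) /= andbT.
  by apply: contraNneq B'0 => <-.
have [X [XB bX XA]] := exchange_circuit bB B0.
have [X0|[a aX]] := set_0Vmem X.
  by move: loopM; rewrite /is_loop; move: bX; rewrite X0 setU0 => ->;
     have := rk_le_card M set0; rewrite cards0 leqn0 => ->.
exists a; rewrite inE /swap (negPf B0) XA // (subsetP XB _ aX) andbT.
by rewrite /= andbT; apply: contraNneq B0 => <-; apply: (subsetP XB).
Qed.

Lemma sum_delete_bases (V : zmodType) (G : {set 'I_n.+1} -> V) :
  \sum_(Y | is_basis D Y) G (up_set Y) =
  \sum_(B | is_basis M B && (ord0 \notin B)) G B.
Proof.
rewrite (reindex_onto (@up_set n) (fun B => lf @^-1: B)) /=; last first.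
  by move=> B /andP[_ B0]; rewrite preim_up_set; apply/setDidPl; rewrite disjoint_sym disjoints1.
by apply: eq_bigl => Y; rewrite up_setK eqxx andbT up_set0 andbT delete_basis.
Qed.

Lemma sum_contract_bases (V : zmodType) (G : {set 'I_n.+1} -> V) :
  \sum_(X | is_basis C X) G (ord0 |: up_set X) =
  \sum_(B | is_basis M B && (ord0 \in B)) G B.
Proof.
rewrite (reindex_onto (fun X => ord0 |: up_set X) (fun B => lf @^-1: B)) /=; last first.
  by move=> B /andP[_ B0]; rewrite preim_up_set setD1K.
apply: eq_bigl => X; rewrite setU11 andbT contract_basis //.
rewrite (_ : _ @^-1: _ = X) ?eqxx ?andbT //; apply/setP => i.
by rewrite !inE mem_up_set eq_sym (negPf (neq_lift _ _)).
Qed.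

(** By cardinality [X] is [Y] minus one element, and the condition on that element is that
    exchanging it for [ord0] gives a basis of [M]. The flags of [(M/0, M\0)] are thus the edges of
    the other sums. *)
Lemma sum_contract_in Y (V : zmodType) (G : {set 'I_n} -> V) : is_basis D Y ->
  \sum_(X | is_basis C X && (X \subset Y)) G X =
  \sum_(x in nbrs (up_set Y)) G (lf @^-1: (up_set Y :\ x)).
Proof.
move=> bY; have nbrsP x : x \in nbrs (up_set Y) ->
    [/\ x \in up_set Y, x != ord0 & is_basis M (ord0 |: up_set Y :\ x)].
  rewrite inE /swap (negPf (up_set0 Y)) => /and3P[x0 + ->].
  by case: (x \in _).
have inj : {in nbrs (up_set Y) &, injective (fun x => lf @^-1: (up_set Y :\ x))}.
  move=> x x' /nbrsP[xY x0 _] /nbrsP[x'Y x'0 _] /= E.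
  case: (unliftP ord0 x) xY x0 E => [z ->|->]; last by rewrite eqxx.
  by move=> xY _ /setP/(_ z); rewrite !inE eqxx xY !andbT /= => /esym/negbFE/eqP.
rewrite -(big_imset _ inj) /=; apply: eq_bigl => X.
apply/andP/imsetP => [[bX XY]|[x /nbrsP[xY x0 bx] ->]].
  have cXY : #|Y| = #|X|.+1.
    case/basisP: bX => -> _; case/basisP: bY => -> _.
    by rewrite -contract_mrank // delete_mrank.
  have /properP[_ [i iY iX]] : X \proper Y by rewrite properEcard XY cXY ltnSn.
  have YE : Y = i |: X.
    apply/eqP; rewrite eq_sym eqEcard subUset sub1set iY XY.
    by rewrite cXY cardsU1 iX leqnn.
  have e : up_set Y :\ lf i = up_set X.
    by rewrite YE /up_set imsetU1 setU1K -?/(up_set X) ?mem_up_set.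
  exists (lf i); last by rewrite e up_setK.
  by rewrite inE /swap (negPf (up_set0 Y)) mem_up_set iY e -contract_basis // bX.
split; last first.
  by apply/subsetP => i; rewrite !inE mem_up_set => /andP[].
rewrite contract_basis // preim_up_set (_ : _ :\ ord0 = up_set Y :\ x) //.
apply/setDidPl; rewrite disjoint_sym disjoints1 inE negb_and; apply/orP; right; exact: up_set0.
Qed.

Section Weight.
Variables u v : Rtv.

(** The weight of a flag of a minor, transported to the ground set of [M] with the factor of [ord0]
    left out. *)
Definition weight0 B B' : Rtv :=
  (\prod_(i in B) tv i) * (\prod_(i in B') (tv i + u)) *
  \prod_(i in ~: (ord0 |: B)) (1 + v * tv i).

(** The factors of elements other than [x] and [ord0] are common to all five terms; a rational
    identity in [t_x] and [t_0] remains. *)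
Lemma weight_exchange B x : ord0 \notin B -> x \in nbrs B ->
  edge_coef true x ord0 *: weight tv u v B B +
  edge_coef false x ord0 *: weight tv u v (swap B x) (swap B x) =
  tfrac 'X_ord0 ^+ 2 *: weight0 (B :\ x) (B :\ x) +
  tfrac 'X_ord0 *: weight0 (B :\ x) B + weight0 B B.
Proof.
move=> B0; rewrite inE /swap (negPf B0) => /and3P[x0].
rewrite eqbF_neg negbK => xB _.
have xC : x \in ~: (ord0 |: B :\ x) by rewrite !inE eqxx orbF.
have x0C : ord0 \in ~: B by rewrite !inE.
have Cx : ~: (ord0 |: B :\ x) :\ x = ~: (ord0 |: B).
  apply/setP => z; rewrite !inE; case: eqVneq => [->|]; rewrite ?xB ?orbT //.
have C0 : ~: B :\ ord0 = ~: (ord0 |: B) by apply/setP => z; rewrite !inE negb_or.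
have S0 : ord0 \in ord0 |: B :\ x by rewrite setU11.
have Bx0 : (ord0 |: B :\ x) :\ ord0 = B :\ x.
  by rewrite setU1K // !inE (negPf B0) andbF.
rewrite /weight /weight0 !(big_setD1 x xC) !(big_setD1 ord0 x0C) !(big_setD1 ord0 S0).
rewrite !(big_setD1 x xB) /= Cx C0 Bx0.
set P := \prod_(j in B :\ x) tv j; set Q := \prod_(j in B :\ x) (tv j + u).
set W := \prod_(j in _) _.
have ne : tfrac 'X_x - tfrac 'X_ord0 != 0 :> ratfun n.+1.
  by rewrite -tfracB tfrac_eq0 mpolyXB_neq0.
(* The inverse of [t_x - t_0] enters as an atom [k]; the right-hand side is later multiplied by
   [k * (a - b) = 1], which leaves a polynomial identity. *)
pose k : Rtv := ((tfrac 'X_x - tfrac 'X_ord0)^-1)%:MP.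
have k1 : k * (tv x - tv ord0) = 1.
  by rewrite /k /tvar -mpolyCB -mpolyCM mulVf ?mpolyC1.
have c1 : (edge_coef true x ord0)%:MP = k * tv x.
  by rewrite /edge_coef /= mulrC mpolyCM.
have c2 : (edge_coef false x ord0)%:MP = - (k * tv ord0).
  by rewrite /edge_coef /= -opprB invrN mulrN mpolyCN mulrC mpolyCM.
rewrite -!mul_mpolyC c1 c2 rmorphXn /= -!/(tv _).
set a := tv x in k1 *; set b := tv ord0 in k1 *.
set lhs := LHS; set rhs := RHS; rewrite -[rhs]mul1r -k1 /lhs /rhs; ring.
Qed.

End Weight.

Lemma up_frac_tfrac (p : {mpoly int[n]}) : up_frac (tfrac p) = tfrac (up_poly p).
Proof.
have := up_fracE p (oner_neq0 _); rewrite (rmorph1 (@up_poly n)) !tfrac1 !divr1.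
by [].
Qed.

Lemma map_weight X Y :
  map_mpoly (@up_frac n) (weight (@tvar n) ('X_ord0 - 1) ('X_ord_max - 1) X Y) =
  weight0 ('X_ord0 - 1) ('X_ord_max - 1) (up_set X) (up_set Y).
Proof.
have mX i : map_mpoly (@up_frac n) 'X_i = 'X_i :> Rtv by rewrite map_mpolyX.
have mt i : map_mpoly (@up_frac n) (tvar i) = tv (lf i).
  by rewrite /tvar map_mpolyC /= up_frac_tfrac /up_poly comp_mpolyXU -tnth_nth tnth_mktuple.
have prodE (A : {set 'I_n}) (f : 'I_n.+1 -> Rtv) :
    \prod_(i in up_set A) f i = \prod_(i in A) f (lf i).
  by rewrite big_imset //= => i j _ _; apply: lift_inj.
have -> : weight0 ('X_ord0 - 1) ('X_ord_max - 1) (up_set X) (up_set Y) =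
    (\prod_(i in up_set X) tv i) * (\prod_(i in up_set Y) (tv i + ('X_ord0 - 1)))
    * \prod_(i in up_set (~: X)) (1 + ('X_ord_max - 1) * tv i).
  congr (_ * _); apply: eq_bigl => i; case: (unliftP ord0 i) => [j ->|->].
    by rewrite !inE !mem_up_set inE eq_sym (negPf (neq_lift _ _)).
  by rewrite (negPf (up_set0 _)) !inE eqxx.
rewrite !prodE /weight !rmorphM !rmorph_prod /=.
congr (_ * _ * _); apply: eq_bigr => i _; first exact: mt.
  by rewrite rmorphD rmorphB rmorph1 /= mt mX.
by rewrite rmorphD rmorphM rmorphB rmorph1 /= mt mX.
Qed.

Lemma map_KTT (N N' : matroid n) (q : matroid_quotient N N') :
  map_mpoly (@up_frac n) (KTT R (flag2 q)) =
  \sum_(X | is_basis N X) \sum_(Y | is_basis N' Y && (X \subset Y))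
    up_frac (Hilb (flag_cone (R := R) (flag2 q) (pair_flag X Y))) *:
    weight0 ('X_ord0 - 1) ('X_ord_max - 1) (up_set X) (up_set Y).
Proof.
rewrite /KTT KTT_shift_flag2 rmorph_sum; apply: eq_bigr => X _.
rewrite rmorph_sum; apply: eq_bigr => Y _.
by rewrite -mul_mpolyC rmorphM /= map_mpolyC map_weight mul_mpolyC.
Qed.

Lemma map_KTT_refl (N : matroid n) :
  map_mpoly (@up_frac n) (KTT R (flag2 (quotient_refl N))) =
  \sum_(X | is_basis N X) up_frac (Hilb (gcone R (exch N X))) *:
    weight0 ('X_ord0 - 1) ('X_ord_max - 1) (up_set X) (up_set X).
Proof.
rewrite /KTT KTT_shift_refl rmorph_sum; apply: eq_bigr => X _.
by rewrite -mul_mpolyC rmorphM /= map_mpolyC map_weight mul_mpolyC.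
Qed.

Let u : Rtv := 'X_ord0 - 1.
Let v : Rtv := 'X_ord_max - 1.

(** Like the next two expansions, this one runs over a basis [B] without [ord0] and a neighbour [x].
    Bases of the contraction correspond to bases containing [ord0], so the sum is moved to the other
    end of each edge. *)
Lemma map_KTT_contract :
  map_mpoly (@up_frac n) (KTT R (flag2 (quotient_refl C))) =
  \sum_(B | is_basis M B && (ord0 \notin B)) \sum_(x in nbrs B)
    Hilb (gcone R (slice_edges M ord0 B (swap B x))) *: weight0 u v (B :\ x) (B :\ x).
Proof.
pose W B := weight0 u v (B :\ ord0) (B :\ ord0).
pose G B := Hilb (gcone R (drop_edges ord0 (exch M B))) *: W B.
transitivity (\sum_(X | is_basis C X) G (ord0 |: up_set X)).
  rewrite map_KTT_refl; apply: eq_bigr => X _; rewrite /G /W Hilb_contract //.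
  by rewrite setU1K ?up_set0.
rewrite sum_contract_bases; under eq_bigl do rewrite -[X in _ && X]eqb_id.
apply: etrans (sum_drop_edges R true W nbrs_neq0) _.
apply: eq_bigr => B /andP[_ B0]; apply: eq_bigr => x _.
by rewrite /W /swap (negPf B0) setU1K // !inE (negPf B0) andbF.
Qed.

Lemma map_KTT_delete :
  map_mpoly (@up_frac n) (KTT R (flag2 (quotient_refl D))) =
  \sum_(B | is_basis M B && (ord0 \notin B)) \sum_(x in nbrs B)
    Hilb (gcone R (slice_edges M ord0 B (swap B x))) *: weight0 u v B B.
Proof.
pose W B := weight0 u v B B.
pose G B := Hilb (gcone R (drop_edges ord0 (exch M B))) *: W B.
transitivity (\sum_(X | is_basis D X) G (up_set X)).
  by rewrite map_KTT_refl; apply: eq_bigr => X _; rewrite /G Hilb_delete.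
rewrite sum_delete_bases; under eq_bigl do rewrite -eqbF_neg.
exact: (sum_drop_edges R false W nbrs_neq0).
Qed.

Lemma map_KTT_contract_delete :
  map_mpoly (@up_frac n) (KTT R (flag2 (contract_delete_quotient M ord0))) =
  \sum_(B | is_basis M B && (ord0 \notin B)) \sum_(x in nbrs B)
    Hilb (gcone R (slice_edges M ord0 B (swap B x))) *: weight0 u v (B :\ x) B.
Proof.
rewrite map_KTT (exchange_big_dep (is_basis D)) /=; last by move=> X Y _ /andP[].
rewrite -sum_delete_bases; apply: eq_bigr => Y bY.
pose W X := Hilb (gcone R (slice_edges M ord0 (ord0 |: up_set X) (up_set Y))) *:
  weight0 u v (up_set X) (up_set Y).
transitivity (\sum_(X | is_basis C X && (X \subset Y)) W X).
  apply: eq_big => [X|X /and3P[bX _ XY]]; first by rewrite bY.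
  by rewrite Hilb_contract_delete.
rewrite sum_contract_in //; apply: eq_bigr => x.
rewrite inE /swap (negPf (up_set0 Y)) => /and3P[x0 _ _].
rewrite /W (_ : up_set (lf @^-1: (up_set Y :\ x)) = up_set Y :\ x).
  by rewrite slice_edgesC.
rewrite preim_up_set; apply/setDidPl; rewrite disjoint_sym disjoints1 inE negb_and.
by rewrite up_set0 orbT.
Qed.

Lemma KTT_deletion_contraction :
  KTT R (flag2 (quotient_refl M)) =
    tfrac 'X_ord0 ^+ 2 *: map_mpoly (@up_frac n) (KTT R (flag2 (quotient_refl C)))
  + tfrac 'X_ord0 *: map_mpoly (@up_frac n)
      (KTT R (flag2 (contract_delete_quotient M ord0)))
  + map_mpoly (@up_frac n) (KTT R (flag2 (quotient_refl D))).
Proof.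
apply: etrans (esym (f_equal3 (fun a b c => tfrac 'X_ord0 ^+ 2 *: a + tfrac 'X_ord0 *: b + c)
  map_KTT_contract map_KTT_contract_delete map_KTT_delete)).
(* Every basis has a neighbour, so the left-hand side also becomes a sum over these pairs, and the
   weights are compared one by one. *)
rewrite /KTT KTT_shift_refl (sum_basis_pairs R M ord0) big1 ?add0r; last first.
  by move=> B /andP[/nbrs_neq0/negPf->].
rewrite !scaler_sumr -!big_split; apply: eq_bigr => B /andP[bB B0].
rewrite /= !scaler_sumr -!big_split; apply: eq_bigr => x xN /=.
rewrite weight_exchange //; move: (Hilb _) => h.
by rewrite !scalerDr !scalerA ![h * _]mulrC.
Qed.

End DeletionContraction.

(** * Integrality of the coefficients *)

Section PrimeDifferences.
Variable n : nat.
Implicit Types (p q : {mpoly int[n]}) (i j : 'I_n) (A : {set 'I_n}).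

(** Reduction modulo the prime [t_i - t_j]. *)
Definition subst_var i j p : {mpoly int[n]} :=
  p \mPo [tuple (if k == i then 'X_j else 'X_k) | k < n].

HB.instance Definition _ i j := GRing.RMorphism.copy (subst_var i j)
  (comp_mpoly [tuple (if k == i then 'X_j else 'X_k) | k < n] : {mpoly int[n]} -> _).

Lemma subst_varX i j k : subst_var i j 'X_k = if k == i then 'X_j else 'X_k.
Proof. by rewrite /subst_var comp_mpolyXU -tnth_nth tnth_mktuple. Qed.

(** The polynomials congruent to their substitution form a ring that contains constants and
    variables. *)
Lemma subst_var_dvd i j p : exists g, p - subst_var i j p = ('X_i - 'X_j) * g.
Proof.
pose Q p := exists g, p - subst_var i j p = ('X_i - 'X_j) * g; rewrite -/(Q p).
have QD p1 p2 : Q p1 -> Q p2 -> Q (p1 + p2).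
  by move=> [g1 h1] [g2 h2]; exists (g1 + g2); rewrite rmorphD opprD addrACA h1 h2 mulrDr.
have Q1 : Q 1 by exists 0; rewrite rmorph1 subrr mulr0.
have QM p1 p2 : Q p1 -> Q p2 -> Q (p1 * p2).
  move=> [g1 h1] [g2 h2]; exists (g1 * p2 + subst_var i j p1 * g2).
  by rewrite rmorphM mulrDr mulrA -h1 mulrCA -h2; ring.
have QX k : Q 'X_k.
  rewrite /Q subst_varX; case: eqP => [->|_]; first by exists 1; rewrite mulr1.
  by exists 0; rewrite subrr mulr0.
elim/mpolyind: p => [|c m p _ _ IHp]; first by exists 0; rewrite rmorph0 subrr mulr0.
apply: QD => //; rewrite -mul_mpolyC; apply: (QM).
  by exists 0; rewrite /subst_var comp_mpolyC subrr mulr0.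
rewrite mpolyXE_id; apply: (big_ind Q Q1 QM) => k _.
by elim: (m k) => [|d IHd]; rewrite ?expr0 // exprS; apply: QM.
Qed.

Lemma subst_var_diff_prod i j p : diff_prod [set~ i] p -> subst_var i j p != 0.
Proof.
case=> s /allP sA ->; rewrite rmorph_prod prodf_seq_neq0; apply/allP => d /sA.
case/and3P=> d12; rewrite !inE => d1 d2 /=.
by rewrite rmorphB /= !subst_varX (negPf d1) (negPf d2) mpolyXB_neq0.
Qed.

Definition fractional A (f : ratfun n) :=
  exists2 q, diff_prod A q & exists p, tfrac q * f = tfrac p.

Lemma asum_fractional A S f : asum A S f -> fractional A f.
Proof.
move=> [p [q [Aq -> _]]]; exists q => //; exists p.
by rewrite mulrC divfK // tfrac_eq0 (diff_prod_neq0 Aq).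
Qed.

Lemma fractionalD A f g : fractional A f -> fractional A g -> fractional A (f + g).
Proof.
move=> [q Aq [p pE]] [q' Aq' [p' pE']]; exists (q * q'); first exact: diff_prodM.
exists (q' * p + q * p'); rewrite tfracD !tfracM -pE -pE'; ring.
Qed.

Lemma fractional_sum A (I : Type) (r : seq I) (P : pred I) (F : I -> ratfun n) :
  (forall k : I, P k -> fractional A (F k)) -> fractional A (\sum_(i <- r | P i) F i).
Proof.
move=> PF; elim/big_ind: _ => //; last exact: fractionalD.
by exists 1; [exact: diff_prod1 | exists 0; rewrite mulr0 tfrac0].
Qed.

Lemma fractionalMr A f p : fractional A f -> fractional A (f * tfrac p).
Proof.
by move=> [q Aq [p' pE]]; exists q => //; exists (p' * p); rewrite mulrA pE tfracM.
Qed.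

(* The differences of variables are prime, and each of them involves some
   variable e that the denominators over [set~ e] avoid. *)
Lemma fractional_integral f : fractional setT f ->
  (forall e, fractional [set~ e] f) -> exists p, f = tfrac p.
Proof.
case=> _ [s sT ->] + fe; elim: s sT => [_|[i j] s IHs /= /andP[/and3P[ij _ _] sT]] [p].
  by rewrite big_nil tfrac1 mul1r; exists p.
rewrite big_cons /=; set q := \prod_(d <- s) _ => pE; apply: IHs => //.
(* The denominator [d] does not involve ['X_i], hence is not divisible by ['X_i - 'X_j]; so [p] is,
   and the factor cancels. *)
have [d Ad [p' pE']] := fe i.
have dp : d * p = ('X_i - 'X_j) * q * p'.
  by apply: tfrac_inj; rewrite tfracM -pE mulrCA pE' -tfracM.
have p0 : subst_var i j p = 0.
  have /(congr1 (subst_var i j)) := dp; rewrite !rmorphM rmorphB /= !subst_varX eqxx.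
  rewrite if_same subrr !mul0r => /eqP; rewrite mulf_eq0.
  by rewrite (negPf (subst_var_diff_prod j Ad)) => /eqP.
have [g] := subst_var_dvd i j p; rewrite p0 subr0 => pg; exists g.
apply: (@mulfI _ (tfrac ('X_i - 'X_j))); first by rewrite tfrac_eq0 mpolyXB_neq0.
by rewrite -tfracM -pg -pE tfracM mulrA.
Qed.

End PrimeDifferences.

(** * Cancellation of the poles for [(M, M)] *)

Section Integrality.
Variables (R : realFieldType) (n : nat) (M : matroid n).
Implicit Type B : {set 'I_n}.

Lemma partial_fraction_exchange (F : fieldType) (x y z g : F) : x - y != 0 ->
  x / (x - y) * z + y / (y - x) * (z - (x - y) * g) = z + y * g.
Proof. by move=> xy; field; rewrite xy -opprB oppr_eq0 xy. Qed.

(** After grouping by edges at [e], the slices avoid [e]. The values of [phi] at the two ends of an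
    edge agree modulo ['X_x - 'X_e], so the two edge coefficients combine without a pole. *)
Lemma sum_bases_fractional e (phi : {set 'I_n} -> {mpoly int[n]}) :
    (forall B a b, is_basis M B -> a \in B -> b \notin B -> is_basis M (b |: B :\ a) ->
      exists g, phi B - phi (b |: B :\ a) = ('X_a - 'X_b) * g) ->
  fractional [set~ e] (\sum_(B | is_basis M B) Hilb (gcone R (exch M B)) * tfrac (phi B)).
Proof.
move=> phiP.
rewrite [\sum_(B | _) _](sum_basis_pairs R M e (fun B => tfrac (phi B) : (ratfun n)^o)).
have dropP D p : p \in drop_edges e D -> p.1 \in [set~ e] /\ p.2 \in [set~ e].
  by rewrite !inE => /and3P[_ -> ->].
apply: fractionalD; apply: fractional_sum => B.
  move=> /andP[bB /eqP N0]; apply/fractionalMr/asum_fractional/asum_gcone => p.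
  (* Without neighbours, no exchange of [B] involves [e]. *)
  by rewrite (exch_star M e) N0 /star imset0 setU0; apply: dropP.
move=> /andP[bB eB]; apply: fractional_sum => x; rewrite inE => /and3P[xe].
rewrite /swap (negPf eB) eqbF_neg negbK => xB bB'.
have [g gE] := phiP _ _ _ bB xB eB bB'.
rewrite (_ : _ + _ = tfrac (phi B + 'X_e * g)); last first.
  have ne : tfrac 'X_x - tfrac 'X_e != 0 :> ratfun n.
    by rewrite -tfracB tfrac_eq0 mpolyXB_neq0.
  have -> : phi (e |: B :\ x) = phi B - ('X_x - 'X_e) * g by rewrite -gE subKr.
  rewrite /edge_coef /= /GRing.scale /= tfracB tfracD !tfracM tfracB.
  exact: partial_fraction_exchange.
by apply/fractionalMr/asum_fractional/asum_gcone => p; apply: dropP.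
Qed.

Lemma sum_bases_integral (phi : {set 'I_n} -> {mpoly int[n]}) :
    (forall B a b, is_basis M B -> a \in B -> b \notin B -> is_basis M (b |: B :\ a) ->
      exists g, phi B - phi (b |: B :\ a) = ('X_a - 'X_b) * g) ->
  exists p, \sum_(B | is_basis M B) Hilb (gcone R (exch M B)) * tfrac (phi B) = tfrac p.
Proof.
move=> phiP; apply: fractional_integral => [|e]; last exact: sum_bases_fractional.
apply: fractional_sum => B _; apply/fractionalMr/asum_fractional/asum_gcone => p _.
by rewrite !inE.
Qed.

Lemma weight_diff (A : comPzRingType) (t : 'I_n -> A) u v B a b :
  a \in B -> b \notin B -> exists g,
  weight t u v B B - weight t u v (b |: B :\ a) (b |: B :\ a) = (t a - t b) * g.
Proof.
move=> aB bB; have ab : a != b by apply: contraNneq bB => <-.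
have aC : a \in ~: (b |: B :\ a) by rewrite !inE eqxx orbF.
have bC : b \in ~: B by rewrite inE.
have bS : b \in b |: B :\ a by rewrite setU11.
have Ca : ~: (b |: B :\ a) :\ a = ~: (b |: B).
  by apply/setP => z; rewrite !inE; case: eqVneq => [->|]; rewrite ?aB ?orbT.
have Cb : ~: B :\ b = ~: (b |: B) by apply/setP => z; rewrite !inE negb_or.
have Sb : (b |: B :\ a) :\ b = B :\ a by rewrite setU1K // !inE (negPf bB) andbF.
rewrite /weight !(big_setD1 a aC) !(big_setD1 b bC) !(big_setD1 b bS).
rewrite !(big_setD1 a aB) /= Ca Cb Sb.
set P := \prod_(j in B :\ a) t j; set Q := \prod_(j in B :\ a) (t j + u).
(* With [x = t a] and [y = t b], the last factor is the quotient of [x (x + u) (1 + v y) - y (y + u)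
   (1 + v x)] by [x - y]. *)
set W := \prod_(j in _) _; exists (P * Q * W * (t a + t b + u + v * t a * t b)).
ring.
Qed.

Lemma rmorph_weight (A A' : comPzRingType) (f : {rmorphism A -> A'})
    (t : 'I_n -> A) (t' : 'I_n -> A') u u' v v' B B' :
    (forall i, f (t i) = t' i) -> f u = u' -> f v = v' ->
  f (weight t u v B B') = weight t' u' v' B B'.
Proof.
move=> ft <- <-; rewrite /weight !rmorphM !rmorph_prod; congr (_ * _ * _).
- by apply: eq_bigr => i _.
- by apply: eq_bigr => i _; rewrite rmorphD /= ft.
- by apply: eq_bigr => i _; rewrite rmorphD rmorphM rmorph1 /= ft.
Qed.

(** The weights lift to integer polynomials [w], where [weight_diff] supplies, coefficient by
    coefficient, the divisibility that [sum_bases_integral] requires. *)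
Lemma KTT_refl_integral m : exists p, (KTT R (flag2 (quotient_refl M)))@_m = tfrac p.
Proof.
pose w B : {mpoly {mpoly int[n]}[2]} :=
  weight (fun i => ('X_i)%:MP) ('X_ord0 - 1) ('X_ord_max - 1) B B.
have wE B : (weight (@tvar n) ('X_ord0 - 1) ('X_ord_max - 1) B B)@_m = tfrac (w B)@_m.
  rewrite /tfrac -mcoeff_map_mpoly; congr (_@__); apply/esym/rmorph_weight => [i||].
  - by rewrite /= map_mpolyC.
  - by rewrite rmorphB rmorph1 /= map_mpolyX.
  - by rewrite rmorphB rmorph1 /= map_mpolyX.
rewrite /KTT KTT_shift_refl raddf_sum /=.
have [|p pE] := @sum_bases_integral (fun B => (w B)@_m).
  move=> B a b _ aB bB _; pose t i : {mpoly {mpoly int[n]}[2]} := ('X_i)%:MP.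
  have [g gE] := weight_diff t ('X_ord0 - 1) ('X_ord_max - 1) aB bB.
  exists g@_m; rewrite -mcoeffB -mcoeffCM mpolyCB; congr (_@__); exact: gE.
exists p; rewrite -pE; apply: eq_bigr => B _.
by rewrite mcoeffZ wE.
Qed.

End Integrality.

(** * Specialization at [t = 1] *)

Section Specialization.
Variable n : nat.

(** Setting [t_0 = 1] provides a left inverse of [up_poly]. *)
Definition drop_vars : n.+1.-tuple {mpoly int[n]} :=
  [tuple (if unlift ord0 i is Some j then 'X_j else 1) | i < n.+1].

Definition drop_var (p : {mpoly int[n.+1]}) : {mpoly int[n]} := p \mPo drop_vars.

HB.instance Definition _ := GRing.RMorphism.copy drop_var
  (comp_mpoly drop_vars : {mpoly int[n.+1]} -> _).

Lemma drop_varX : drop_var 'X_ord0 = 1.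
Proof. by rewrite /drop_var comp_mpolyXU -tnth_nth tnth_mktuple unlift_none. Qed.

Lemma up_polyK (p : {mpoly int[n]}) : drop_var (up_poly p) = p.
Proof.
elim/mpolyind: p => [|c m p _ _ IHp]; first by rewrite !rmorph0.
rewrite !rmorphD /= IHp; congr (_ + _).
rewrite -mul_mpolyC !rmorphM /= /up_poly /drop_var !comp_mpolyC; congr (_ * _).
rewrite -/(drop_var _) comp_mpolyX rmorph_prod [RHS]mpolyXE_id; apply: eq_bigr => i _.
rewrite tnth_mktuple rmorphXn /= /drop_var comp_mpolyXU -tnth_nth tnth_mktuple.
by rewrite liftK.
Qed.

(** Clearing denominators and setting [t_0 = 1] shows that the denominator of [f] divides its
    numerator. *)
Lemma up_frac_integral (f : ratfun n) (q : {mpoly int[n.+1]}) :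
  tfrac 'X_ord0 * up_frac f = tfrac q -> exists p, f = tfrac p.
Proof.
have d0 : \d_(repr f) != 0 by apply: denom_ratioP.
rewrite {1 2}(frac_numden f) up_fracE //; set a := \n_ _; set b := \d_ _ in d0 *.
have b0 : tfrac (up_poly b) != 0 by rewrite tfrac_eq0 up_poly_eq0.
rewrite mulrA -tfracM => /(canRL (mulfVK b0)); rewrite -tfracM => /tfrac_inj.
move=> /(congr1 drop_var); rewrite !rmorphM /= drop_varX !up_polyK mul1r => ->.
by exists (drop_var q); rewrite tfracM mulfK // tfrac_eq0.
Qed.

Lemma laurent_at1_tfrac (p : {mpoly int[n]}) : laurent_at1 (tfrac p) = p.@[fun=> 1].
Proof.
by rewrite -(laurent_at1E p 0%MM) mpolyX0 tfrac1 divr1.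
Qed.

Lemma meval1_up_poly (p : {mpoly int[n]}) : (up_poly p).@[fun=> 1] = p.@[fun=> 1].
Proof.
by rewrite /up_poly comp_mpoly_meval; apply: meval_eq => i; rewrite tnth_mktuple mevalXU.
Qed.

(* laurent_at1 is not additive, so mcoeff_map_mpoly does not apply. *)
Lemma KT_coef (R : realFieldType) k (F : flag_matroid n k) m :
  (KT R F)@_m = laurent_at1 (KTT R F)@_m.
Proof.
rewrite /KT /map_mpoly /mmap raddf_sum /=.
under eq_bigr do rewrite mmap1_id mcoeffCM mcoeffX.
have [mF|mF] := boolP (m \in msupp (KTT R F)).
  rewrite (bigD1_seq m) ?msupp_uniq //= eqxx mulr1 big1 ?addr0 //.
  by move=> m' /negPf ->; rewrite mulr0.
rewrite (memN_msupp_eq0 mF) -tfrac0 laurent_at1_tfrac meval0 big1_seq //.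
move=> m' /= m'F; case: eqP => [e|_]; last by rewrite mulr0.
by rewrite -e m'F in mF.
Qed.

Lemma KT_eval (R : realFieldType) k (F : flag_matroid n k) m p :
  (KTT R F)@_m = tfrac p -> (KT R F)@_m = p.@[fun=> 1].
Proof. by move=> Fp; rewrite KT_coef Fp laurent_at1_tfrac. Qed.

(** Isolating the middle term makes [t_0] times the lifted coefficient of [H] a polynomial, and
    [up_frac_integral] applies. At [t = 1] the powers of [t_0] become 1. *)
Lemma coef_specialize (F : {mpoly (ratfun n.+1)[2]}) (G H K : {mpoly (ratfun n)[2]})
    m a c d :
    F = tfrac 'X_ord0 ^+ 2 *: map_mpoly (@up_frac n) G
        + tfrac 'X_ord0 *: map_mpoly (@up_frac n) H + map_mpoly (@up_frac n) K ->
    F@_m = tfrac a -> G@_m = tfrac c -> K@_m = tfrac d ->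
  exists2 f, H@_m = tfrac f &
    a.@[fun=> 1] = c.@[fun=> 1] + f.@[fun=> 1] + d.@[fun=> 1].
Proof.
have mE P : (map_mpoly (@up_frac n) P)@_m = up_frac P@_m by rewrite mcoeff_map_mpoly.
move: (mE G) (mE H) (mE K).
move: (map_mpoly _ G) (map_mpoly _ H) (map_mpoly _ K) => g h k gE hE kE.
move=> /(congr1 (mcoeff m)) + aE cE dE.
rewrite aE cE dE !up_frac_tfrac in gE kE *.
rewrite mcoeffD kE mcoeffD mcoeffZ gE mcoeffZ hE => eqm.
have [f fE] : exists f, H@_m = tfrac f.
  apply: (@up_frac_integral _ (a - 'X_ord0 ^+ 2 * up_poly c - up_poly d)).
  by rewrite !tfracB tfracM expr2 tfracM -expr2 eqm; ring.
exists f => //.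
move: eqm; rewrite fE up_frac_tfrac expr2 -!tfracM -!tfracD => /tfrac_inj ->.
by rewrite !mevalD !mevalM !mevalXU !mul1r !meval1_up_poly.
Qed.

End Specialization.

Theorem theorem6p8 (R : realType) (n r : nat) (M : matroid n.+1)
    (rkM : mrank M = r) (loopM : ~~ is_loop M ord0)
    (coloopM : ~~ is_coloop M ord0) :
  let MM := flag2 (quotient_refl M) in
  let CC := flag2 (quotient_refl (contract M ord0)) in
  let CD := flag2 (contract_delete_quotient M ord0) in
  let DD := flag2 (quotient_refl (delete M ord0)) in
  let t0 : ratfun n.+1 := tfrac 'X_ord0 in
  KTT R MM = t0 ^+ 2 *: map_mpoly (@up_frac n) (KTT R CC)
             + t0 *: map_mpoly (@up_frac n) (KTT R CD)
             + map_mpoly (@up_frac n) (KTT R DD)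
  /\ KT R MM = KT R CC + KT R CD + KT R DD.
Proof.
cbv zeta; have eqT := KTT_deletion_contraction R loopM coloopM.
split; first exact: eqT.
apply/mpolyP => m.
have [a aE] := KTT_refl_integral R M m.
have [c cE] := KTT_refl_integral R (contract M ord0) m.
have [d dE] := KTT_refl_integral R (delete M ord0) m.
(* Integrality for [(M/0, M\0)] is extracted from the equivariant identity and the three other
   cases. *)
have [f fE aDE] := coef_specialize eqT aE cE dE.
have sumE (F G H K : {mpoly int[2]}) a' c' f' d' : F@_m = a' -> G@_m = c' ->
    H@_m = f' -> K@_m = d' -> a' = c' + f' + d' -> F@_m = (G + H + K)@_m.
  by move=> -> <- <- <-; rewrite !mcoeffD.
exact: (sumE _ _ _ _ _ _ _ _ (KT_eval aE) (KT_eval cE) (KT_eval fE) (KT_eval dE) aDE).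
Qed.
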